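(* Let $d=2n+1\ge 3$ be an odd integer and let $\mu$ be a finite complex Borel measure on $\mathbb{R}^d$ with compact support. Let $\mathbf{H}_\mu$ be the matrix with entries $\int f_\alpha\overline{f_\beta}\,d\mu$, where $(f_\alpha)$ runs over a system of harmonic polynomials on $\mathbb{R}^d$ spanning the space of all harmonic polynomials. If $\mathbf{H}_\mu$ has finite rank $m$, then $\operatorname{supp}\mu$ consists of at most $m$ points.
   Context: The rank of $\mathbf{H}_\mu$ does not depend on the choice of the spanning system of harmonic polynomials. *)

(* Defs.v *)
From HB Require Import structures.
From mathcomp Require Import all_boot all_order all_algebra.
From mathcomp Require Import complex.
From mathcomp Require Import mpoly.
From mathcomp Require Import all_classical all_reals all_analysis.

Set Implicit Arguments.
Unset Strict Implicit.
Unset Printing Implicit Defensive.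

Import Order.TTheory GRing.Theory Num.Theory.
Import numFieldNormedType.Exports.

Local Open Scope classical_set_scope.
Local Open Scope ring_scope.

Notation Rd R d := 'rV[R]_d (only parsing).

Definition borelRd (R : realType) (d : nat) :=
  g_sigma_algebraType (@open (Rd R d)).

(** A finite complex Borel measure mu on R^d, given through a (Jordan-type)
    decomposition  mu = (cm_rp - cm_rn) + i (cm_ip - cm_in)  into four finite
    positive Borel measures.  Every finite complex Borel measure is of this
    form. *)
Record cmeasure (R : realType) (d : nat) := CMeasure {
  cm_rp : {finite_measure set (borelRd R d) -> \bar R};
  cm_rn : {finite_measure set (borelRd R d) -> \bar R};
  cm_ip : {finite_measure set (borelRd R d) -> \bar R};
  cm_in : {finite_measure set (borelRd R d) -> \bar R} }.

Section ComplexMeasure.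
Variables (R : realType) (d : nat) (mu : cmeasure R d).

Definition cmval (B : set (borelRd R d)) : R[i] :=
  Complex (fine (cm_rp mu B) - fine (cm_rn mu B))
          (fine (cm_ip mu B) - fine (cm_in mu B)).

Definition cint_pos (m : {finite_measure set (borelRd R d) -> \bar R})
  (F : Rd R d -> R[i]) : R[i] :=
  Complex (Rintegral m setT (fun x => complex.Re (F x)))
          (Rintegral m setT (fun x => complex.Im (F x))).

Definition cintegral (F : Rd R d -> R[i]) : R[i] :=
  (cint_pos (cm_rp mu) F - cint_pos (cm_rn mu) F)
  + 'i%C * (cint_pos (cm_ip mu) F - cint_pos (cm_in mu) F).

(** Support of mu: the points x all of whose open neighbourhoods U contain a
    Borel set B with mu(B) <> 0 (i.e. the complement of the largest open set
    on which mu vanishes). *)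
Definition csupport : set (Rd R d) :=
  [set x | forall U : set (Rd R d), open U -> U x ->
     exists B : set (borelRd R d), [/\ measurable B, B `<=` U & cmval B != 0]].

(** mu has compact support, and (so that integrals of polynomials are well
    defined) its four components are concentrated on a common compact set. *)
Definition cm_compactly_supported : Prop :=
  compact csupport /\
  exists K : set (Rd R d), compact K /\
    [/\ cm_rp mu (~` K) = 0%E, cm_rn mu (~` K) = 0%E,
        cm_ip mu (~` K) = 0%E & cm_in mu (~` K) = 0%E].

End ComplexMeasure.

Section Harmonic.
Variables (R : realType) (d : nat).

Local Notation cpoly := (mpoly.mpoly d R[i]).

Definition laplacian (p : cpoly) : cpoly :=
  \sum_(i < d) mpoly.mderiv i (mpoly.mderiv i p).

Definition harmonic (p : cpoly) : Prop := laplacian p = 0.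

Definition peval (p : cpoly) (x : Rd R d) : R[i] :=
  mpoly.meval (fun i => (x ord0 i)%:C%C) p.

Definition harmonic_spanning (I : Type) (f : I -> cpoly) : Prop :=
  (forall a, harmonic (f a)) /\
  (forall p, harmonic p -> exists (k : nat) (a : 'I_k -> I) (c : 'I_k -> R[i]),
       p = \sum_(j < k) c j *: f (a j)).

Definition Hmx (mu : cmeasure R d) (I : Type) (f : I -> cpoly) :
  I -> I -> R[i] :=
  fun a b => cintegral mu (fun x => peval (f a) x * conjc (peval (f b) x)).

End Harmonic.

Notation cpoly R d := (mpoly.mpoly d R[i]) (only parsing).

(** Rank of an (infinite) matrix indexed by I x J: the supremum of the ranks
    of its finite submatrices.  [infmx_rank_eq H m]: H has finite rank m. *)
Definition infmx_rank_eq (F : fieldType) (I J : Type) (H : I -> J -> F)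
  (m : nat) : Prop :=
  (forall (k l : nat) (a : 'I_k -> I) (b : 'I_l -> J),
      (\rank (\matrix_(i < k, j < l) H (a i) (b j)) <= m)%N) /\
  exists (k l : nat) (a : 'I_k -> I) (b : 'I_l -> J),
      \rank (\matrix_(i < k, j < l) H (a i) (b j)) = m.

(* Main.v *)
(** For isotropic [a] in [C^d] (real and imaginary parts orthogonal of equal
    length) the polynomials in [a . x] are harmonic, so the finite rank of [H_mu]
    passes to the matrix [int p conj q dnu] of analytic polynomials of the
    push-forward [nu] of [mu] to the plane.  Luecking's argument then applies:
    the vanishing of all (m+1)-minors says that [|V|^2 nu^(m+1)], [V] being the
    Vandermonde polynomial, kills [S conj T] for symmetric polynomials [S], [T];
    by Stone-Weierstrass it kills every symmetric continuous function.  Hence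
    [nu] has rank at most [m] against all continuous functions, and is a sum of
    at most [m] point masses.

    Planes are glued as follows.  Choose a direction [xi] for which the
    push-forward of [mu] to a line has the largest number of atoms.  For every
    [eta], the atoms of the push-forward under [(xi, eta)] correspond bijectively
    to those under [xi], with the same weights, and their [eta]-coordinates are
    linear in [eta].  So [mu] has the moments of a discrete measure with at most
    [m] atoms, and therefore equals it. *)

Require Import Defs.
From HB Require Import structures.
From mathcomp Require Import all_boot all_order all_algebra.
From mathcomp Require Import complex.
From mathcomp Require Import mpoly.
From mathcomp Require Import fingroup perm finmap.
From mathcomp Require Import all_classical all_reals all_analysis.
From mathcomp Require Import measurable_realfun ring lra.

Set Implicit Arguments.
Unset Strict Implicit.
Unset Printing Implicit Defensive.

Import Order.TTheory GRing.Theory Num.Theory.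
Import numFieldNormedType.Exports.

Local Open Scope classical_set_scope.
Local Open Scope ring_scope.

(** * Stone-Weierstrass *)

(** Neither the push-forward [nu] nor the product [nu^(m+1)] is built. Integration against [mu]
    becomes a linear functional bounded by suprema over a compact set; functions on the plane become
    functions on [R^d] that are constant on the fibres of [zeta]; the tensor power of the functional
    is defined on finite sums of products of one-variable functions, and a supremum bound makes it
    well defined. The vanishing minors control only multiples of [|V|^2], and division by [|V|^2]
    breaks down where two points collide. The functions that matter are products of two determinants
    [det (u_j (x_i))] and [det (h_j (x_i))]; these vanish at collisions, so they can be approximated
    uniformly by such multiples. The functional is not positive, so atoms are found algebraically:
    the powers [1, s, ..., s^m] of a real function [s] are dependent modulo the functional, which
    gives a polynomial in [s] that annihilates it. Only distinct real roots matter, because [s] is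
    real and because a functional bounded by suprema contains no derivatives of point masses. *)

Lemma compact_finite_choice (T : topologicalType) (K : set T)
    (P : T -> set T) :
  compact K -> (forall x, K x -> open (P x)) -> (forall x, K x -> P x x) ->
  exists s : seq T, (forall x, x \in s -> K x) /\
    forall z, K z -> exists2 x, x \in s & P x z.
Proof.
move=> cK oP PP.
have [K0|/set0P[x0 Kx0]] := eqVneq K set0.
  by exists [::]; split => // z; rewrite K0.
(* Pointing [T] at an element of [K] gives access to the open-cover form of compactness. *)
pose pT : ptopologicalType := HB.pack (T : Type) (isPointed.Build T x0)
  (Topological.class T).
have : cover_compact (T := pT) K by rewrite -compact_cover.
move=> /(_ _ K P oP)[|D DK KD]; first by move=> x Kx; exists x => //; exact: PP.
exists (enum_fset D); split => [x xD|z /KD[x /= xD Pxz]]; last by exists x.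
by have := DK x xD; rewrite inE.
Qed.

Section StoneWeierstrass.
Context {R : realType} {T : topologicalType}.
Variables (K : set T) (A : set (T -> R)).
Hypotheses (cK : compact K) (contA : forall a, A a -> continuous a).
Hypotheses (A_cst : forall c, A (fun=> c)).
Hypotheses (A_add : forall a b, A a -> A b -> A (fun x => a x + b x)).
Hypotheses (A_mul : forall a b, A a -> A b -> A (fun x => a x * b x)).

(** The uniform closure of [A] on [K], to be shown a lattice. Continuity on all of [T] is carried
    along because the covering argument needs open subsets of [T]. *)
Let cl (f : T -> R) := continuous f /\
  forall e : R, 0 < e -> exists2 a, A a & forall x, K x -> `|f x - a x| < e.

Let cl_A a : A a -> cl a.
Proof.
by move=> Aa; split; [exact: contA|move=> e e0; exists a => // x _; rewrite subrr normr0].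
Qed.

Let cl_add (f g : T -> R) : cl f -> cl g -> cl (fun x => f x + g x).
Proof.
move=> [cf af] [cg ag]; split; first by move=> x; apply: cvgD; [exact: cf|exact: cg].
move=> e e0; have e2 : 0 < e / 2 by lra.
have [a Aa fa] := af _ e2; have [b Ab gb] := ag _ e2.
exists (fun x => a x + b x); first exact: A_add.
move=> x Kx; have := fa x Kx; have := gb x Kx.
rewrite !ltr_norml; lra.
Qed.

Let cl_scale c f : cl f -> cl (fun x => c * f x).
Proof.
move=> [cf af]; split.
  by move=> x; apply: cvgM; [exact: cvg_cst|exact: cf].
move=> e e0; have c0 : 0 < `|c| + 1 by rewrite ltr_wpDl.
have [a Aa fa] := af _ (divr_gt0 e0 c0).
exists (fun x => c * a x); first by apply: A_mul => //; exact: A_cst.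
move=> x Kx; rewrite -mulrBr normrM.
have := fa x Kx; rewrite ltr_pdivlMr// mulrC; apply: le_lt_trans.
by rewrite ler_wpM2r// lerDl.
Qed.

Let compact_ubound (f : T -> R) : continuous f ->
  exists2 M : R, 0 < M & forall x, K x -> `|f x| < M.
Proof.
move=> cf; have [->|/set0P K0] := eqVneq K set0; first by exists 1.
have [c _ fc] : exists2 c, c \in K & forall t, t \in K -> `|f t| <= `|f c|.
  apply: (@compact_EVT_max _ _ (fun x => `|f x|)) => //.
  by apply: continuous_subspaceT => x; apply: cvg_norm; exact: cf.
exists (`|f c| + 1); first by rewrite ltr_wpDl.
by move=> x Kx; rewrite ltr_pwDr// fc// inE.
Qed.

(* The iteration [g <- g + (t^2 - g^2) / 2] converges to [|t|], uniformly for
   [|t| <= 1]. *)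
Let abs_step (n : nat) (t g : R) : 0 <= g -> g <= t -> t <= 1 ->
  t - g <= 2 / n.+1%:R ->
  [/\ 0 <= g + (t ^+ 2 - g ^+ 2) / 2, g + (t ^+ 2 - g ^+ 2) / 2 <= t &
      t - (g + (t ^+ 2 - g ^+ 2) / 2) <= 2 / n.+2%:R].
Proof.
move=> g0 gt t1 H.
have E : t - (g + (t ^+ 2 - g ^+ 2) / 2) = (t - g) * (1 - (t + g) / 2) by field.
have d0 : 0 <= t - g by rewrite subr_ge0.
have tg1 : 0 <= 1 - (t + g) / 2 by lra.
split.
- rewrite addr_ge0// mulr_ge0 ?invr_ge0// subr_sqr mulr_ge0//; lra.
- by rewrite -subr_ge0 E mulr_ge0.
have dtg : t - g <= t + g by lra.
have d1 : t - g <= 1 by lra.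
rewrite E; move: (t - g) (t + g) d0 d1 dtg H {E tg1 g0 gt t1} => d s d0 d1 ds H.
have le1 : d * (1 - s / 2) <= d * (1 - d / 2) by apply: ler_wpM2l => //; lra.
apply: le_trans le1 _.
(* The map [d * (1 - d / 2)] increases up to [d = 1], so [d] may be replaced by its bound
   [2 / (n + 1)] once that bound is at most 1. For [n = 0] the bound is 2, hence the separate
   case. *)
have [->|n0] := posnP n.
  rewrite divff//; have : d * (1 - d / 2) <= 1 * 1 by apply: ler_pM; lra.
  by rewrite mulr1.
have [k k1 [ek1 ek2]] : exists2 k : R, 1 <= k & n.+1%:R = k + 1 /\ n.+2%:R = k + 2 :> R.
  by exists n%:R; rewrite ?ler1n// natr1 -natrD addn2.
rewrite {}ek1 in H; rewrite {}ek2 => {n n0}.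
have w1 : 2 / (k + 1) <= 1 by rewrite ler_pdivrMr; lra.
have : 0 <= (2 / (k + 1) - d) * (1 - (2 / (k + 1) + d) / 2).
  by rewrite mulr_ge0//; lra.
have -> : (2 / (k + 1) - d) * (1 - (2 / (k + 1) + d) / 2) =
    2 / (k + 1) - 2 / (k + 1) ^+ 2 - d * (1 - d / 2).
  by field; rewrite gt_eqF//; lra.
have -> : 2 / (k + 2) = 2 / (k + 1) - 2 / (k + 1) ^+ 2 +
    2 / ((k + 1) ^+ 2 * (k + 2)).
  by field; rewrite !gt_eqF//; lra.
have : 0 <= 2 / ((k + 1) ^+ 2 * (k + 2)).
  by rewrite divr_ge0// mulr_ge0 ?sqr_ge0//; lra.
lra.
Qed.

Let cl_abs f : cl f -> cl (fun x => `|f x|).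
Proof.
move=> [cf af]; split; first by move=> x; apply: cvg_norm; exact: cf.
move=> e e0; have e2 : 0 < e / 2 by lra.
have [a Aa fa] := af _ e2.
have [M M0 aM] := compact_ubound (contA Aa).
pose b x := M^-1 * a x.
have Ab : A b by apply: A_mul => //; exact: A_cst.
have b1 x : K x -> `|b x| <= 1.
  move=> Kx; rewrite /b normrM gtr0_norm ?invr_gt0// ler_pdivrMl// mulr1.
  exact/ltW/aM.
(* After rescaling by [M], the error [2 / (n + 1)] of the iteration has to fit into [e / 2]. *)
have [n nle] : exists n : nat, 2 / n.+1%:R * M < e / 2.
  exists (Num.truncn (M * 4 / e)).
  have := truncnS_gt (M * 4 / e).
  rewrite ltr_pdivrMr// => h.
  by rewrite mulrAC ltr_pdivrMr//; lra.
have [g Ag gb] : exists2 g, A g & forall x, K x ->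
    [/\ 0 <= g x, g x <= `|b x| & `|b x| - g x <= 2 / n.+1%:R].
  elim: n {nle} => [|n [g Ag IH]].
    exists (fun=> 0); first exact: A_cst.
    move=> x Kx; have := b1 x Kx; have := normr_ge0 (b x).
    by rewrite divr1 => h1 h2; split => //; lra.
  exists (fun x => g x + 2^-1 * (b x * b x + (-1) * (g x * g x))).
    apply: A_add => //; apply: A_mul; first exact: A_cst.
    apply: A_add; first exact: A_mul.
    by apply: A_mul; [exact: A_cst|exact: A_mul].
  move=> x Kx; have [g0 gb gn] := IH x Kx.
  have [] := abs_step g0 gb (b1 x Kx) gn.
  have -> : `|b x| ^+ 2 = b x * b x by rewrite -normrX ger0_norm ?sqr_ge0// expr2.
  have -> : g x + (b x * b x - g x ^+ 2) / 2 =
    g x + 2^-1 * (b x * b x + (-1) * (g x * g x)) by field.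
  by [].
exists (fun x => M * g x); first by apply: A_mul => //; exact: A_cst.
move=> x Kx; have [g0 gbx gn] := gb x Kx.
have -> : `|f x| - M * g x = (`|f x| - `|a x|) + M * (`|b x| - g x).
  rewrite /b normrM gtr0_norm ?invr_gt0//; field; by rewrite gt_eqF.
have h1 : `| `|f x| - `|a x| | < e / 2.
  by apply: le_lt_trans (fa x Kx); exact: ler_dist_dist.
have h2 : M * (`|b x| - g x) < e / 2.
  by apply: le_lt_trans nle; rewrite mulrC ler_wpM2r// ltW.
have h3 : 0 <= M * (`|b x| - g x) by apply: mulr_ge0; [exact: ltW|rewrite subr_ge0].
move: h1; rewrite !ltr_norml; lra.
Qed.

Let cl_max f g : cl f -> cl g -> cl (fun x => Num.max (f x) (g x)).
Proof.
move=> cf cg.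
rewrite (_ : (fun x => Num.max (f x) (g x)) =
    (fun x => 2^-1 * ((f x + g x) + `|f x + (-1) * g x|))).
  by apply: cl_scale; apply: cl_add; [exact: cl_add|];
    apply: cl_abs; apply: cl_add => //; exact: cl_scale.
apply/funext => x; rewrite maxr_absE mulrC; congr (_ * (_ + `|_|)).
by rewrite mulN1r.
Qed.

Let cl_min f g : cl f -> cl g -> cl (fun x => Num.min (f x) (g x)).
Proof.
move=> cf cg.
rewrite (_ : (fun x => Num.min (f x) (g x)) =
    (fun x => (-1) * Num.max ((-1) * f x) ((-1) * g x))).
  by apply: cl_scale; apply: cl_max; exact: cl_scale.
by apply/funext => x; rewrite !mulN1r -oppr_min opprK.
Qed.

(** Stone's lattice argument. [A] is not asked to separate points; instead [f] respects the
    identifications that [A] makes. This form covers symmetric functions and functions of a single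
    linear form. *)
Lemma stone_weierstrass (f : T -> R) : continuous f ->
  (forall x y, K x -> K y -> (forall a, A a -> a x = a y) -> f x = f y) ->
  forall e : R, 0 < e -> exists2 a, A a & forall x, K x -> `|f x - a x| < e.
Proof.
move=> cf sep e e0.
suff [g [_ cg] gf] : exists2 g, cl g & forall x, K x -> `|f x - g x| < e / 2.
  have e2 : 0 < e / 2 by lra.
  have [a Aa ga] := cg _ e2; exists a => // x Kx.
  have := ga x Kx; have := gf x Kx; rewrite !ltr_norml; lra.
have {}e0 : 0 < e / 2 by lra.
move: (e / 2) e0 => {}e e0.
have interp x y : K x -> K y -> exists2 a, A a & a x = f x /\ a y = f y.
  move=> Kx Ky; have [fxy|fxy] := eqVneq (f x) (f y).
    by exists (fun=> f x).
  have [b Ab bxy] : exists2 b, A b & b x != b y.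
    apply: contrapT => nb; move/eqP: fxy; apply; apply: sep => // a Aa.
    by apply/eqP; apply: contrapT => /negP axy; apply: nb; exists a.
  exists (fun z => f x + (f y - f x) / (b y - b x) * (b z + - b x)).
    by apply: A_add => //; apply: A_mul => //; apply: A_add.
  rewrite subrr mulr0 addr0 divfK ?subr_eq0 1?eq_sym//; split => //; ring.
(* A finite maximum of two-point interpolants through [x] stays above [f - e] on [K] and equals [f]
   at [x]. A finite minimum of these over [x] will then also stay below [f + e]. *)
have above x : K x -> exists g, [/\ cl g, g x = f x & forall z, K z -> f z - e < g z].
  move=> Kx.
  have /choice[a Pa] y : exists a, K y -> A a /\ (a x = f x /\ a y = f y).
    have [Ky|nKy] := pselect (K y); last by exists f.
    by have [a ? ?] := interp x y Kx Ky; exists a.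
  have [||s [sK Ks]] := @compact_finite_choice _ K (fun y => [set z | f z - a y z < e]) cK.
  - move=> y Ky; apply: (@open_comp _ _ (fun z => f z - a y z) [set r | r < e]).
      move=> z _; apply: cvgB; [exact: cf|exact: (contA (Pa y Ky).1)].
    exact: open_lt.
  - by move=> y Ky /=; rewrite (Pa y Ky).2.2 subrr.
  suff [g [cg gx gs]] : exists g, [/\ cl g, g x = f x &
      forall y z, y \in s -> a y z <= g z].
    exists g; split => // z Kz; have [y ys /= yz] := Ks z Kz.
    by have := gs y z ys; lra.
  elim: s sK {Ks} => [|y s IH] sK.
    exists (fun=> f x); split => //; exact: cl_A.
  have [|g [cg gx gs]] := IH; first by move=> z zs; apply: sK; rewrite inE zs orbT.
  have [Aay [ayx _]] := Pa y (sK y (mem_head _ _)).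
  exists (fun z => Num.max (a y z) (g z)); split; first exact/cl_max/cg/cl_A.
    by rewrite ayx gx maxxx.
  move=> w z; rewrite inE le_max => /orP[/eqP ->|ws]; first by rewrite lexx.
  by rewrite gs ?orbT.
have /choice[g Pg] x : exists g, K x ->
    [/\ cl g, g x = f x & forall z, K z -> f z - e < g z].
  have [Kx|nKx] := pselect (K x); last by exists f.
  by have [g ?] := above x Kx; exists g.
have [K0|[x0 Kx0]] : (forall x, ~ K x) \/ exists x, K x.
- by have [->|/set0P nK] := eqVneq K set0; [left=> x|right; exact: nK].
- by exists (fun=> 0); [exact/cl_A/A_cst|move=> x /K0].
have [||s [sK Ks]] := @compact_finite_choice _ K (fun y => [set z | g y z - f z < e]) cK.
- move=> y Ky; have [[cgy _] _ _] := Pg y Ky.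
  apply: (@open_comp _ _ (fun z => g y z - f z) [set r | r < e]).
    by move=> z _; apply: cvgB; [exact: cgy|exact: cf].
  exact: open_lt.
- by move=> y Ky /=; have [_ -> _] := Pg y Ky; rewrite subrr.
suff [h [ch hlo hs]] : exists h, [/\ cl h, forall z, K z -> f z - e < h z &
    forall y z, y \in s -> h z <= g y z].
  exists h => // z Kz; have [y ys /= yz] := Ks z Kz.
  have := hs y z ys; have := hlo z Kz; rewrite ltr_norml; lra.
elim: s sK {Ks} => [|y s IH] sK.
  by have [cg _ glo] := Pg x0 Kx0; exists (g x0); split.
have [|h [ch hlo hs]] := IH; first by move=> z zs; apply: sK; rewrite inE zs orbT.
have [cgy _ gylo] := Pg y (sK y (mem_head _ _)).
exists (fun z => Num.min (g y z) (h z)); split; first exact: cl_min.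
  by move=> z Kz; rewrite lt_min gylo// hlo.
move=> w z; rewrite inE ge_min => /orP[/eqP ->|ws]; first by rewrite lexx.
by rewrite hs ?orbT.
Qed.

End StoneWeierstrass.

(** * Complex-valued continuous functions and bounded functionals *)

Section ComplexContinuity.
Context {R : realType}.
Local Notation C := R[i].
Implicit Types z w : C.

(** The norm of [R[i]] takes its values in [R[i]]; this real-valued version keeps all estimates in
    [R]. *)
Definition cn z : R := ComplexField.Normc.normc z.

Lemma cn_ge0 z : 0 <= cn z.
Proof. by case: z => a b; rewrite sqrtr_ge0. Qed.

Lemma cn0 : cn 0 = 0. Proof. exact: ComplexField.Normc.normc0. Qed.

Lemma cn0_eq0 z : cn z = 0 -> z = 0.
Proof. exact: ComplexField.Normc.eq0_normc. Qed.

Lemma cnM z w : cn (z * w) = cn z * cn w.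
Proof. exact: ComplexField.Normc.normcM. Qed.

Lemma cnD z w : cn (z + w) <= cn z + cn w.
Proof. exact: (@le_normcD R). Qed.

Lemma cnN z : cn (- z) = cn z.
Proof. exact: (@normcN R). Qed.

Lemma cnB z w : cn (z - w) <= cn z + cn w.
Proof. by rewrite -(cnN w) cnD. Qed.

Lemma cn_real (r : R) : cn r%:C%C = `|r|.
Proof. by rewrite /cn /= expr0n addr0 sqrtr_sqr. Qed.

Lemma cn_sqr z : cn z ^+ 2 = complex.Re z ^+ 2 + complex.Im z ^+ 2.
Proof. by case: z => a b; rewrite /cn /= sqr_sqrtr// addr_ge0// sqr_ge0. Qed.

Lemma mul_conjc z : z * conjc z = (cn z ^+ 2)%:C%C.
Proof.
rewrite cn_sqr; case: z => a b; apply/eqP; rewrite eq_complex /=.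
by apply/andP; split; apply/eqP; ring.
Qed.

Lemma Re_le_cn z : `|complex.Re z| <= cn z.
Proof.
rewrite -(ler_pXn2r (_ : (0 < 2)%N)) ?nnegrE ?cn_ge0//.
by rewrite cn_sqr real_normK ?num_real// lerDl sqr_ge0.
Qed.

Lemma Im_le_cn z : `|complex.Im z| <= cn z.
Proof.
rewrite -(ler_pXn2r (_ : (0 < 2)%N)) ?nnegrE ?cn_ge0//.
by rewrite cn_sqr real_normK ?num_real// lerDr sqr_ge0.
Qed.

Lemma cn_le z : cn z <= `|complex.Re z| + `|complex.Im z|.
Proof.
rewrite {1}(complexE z) (le_trans (cnD _ _))// cnM !cn_real lerD//.
by rewrite {1}/cn /= expr0n expr1n add0r sqrtr1 mul1r.
Qed.

Lemma ReD z w : complex.Re (z + w) = complex.Re z + complex.Re w.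
Proof. by case: z w => [a b] [c d]. Qed.

Lemma ImD z w : complex.Im (z + w) = complex.Im z + complex.Im w.
Proof. by case: z w => [a b] [c d]. Qed.

Lemma ReM z w : complex.Re (z * w) =
  complex.Re z * complex.Re w - complex.Im z * complex.Im w.
Proof. by case: z w => [a b] [c d]. Qed.

Lemma ImM z w : complex.Im (z * w) =
  complex.Re z * complex.Im w + complex.Im z * complex.Re w.
Proof. by case: z w => [a b] [c d]. Qed.

Definition ccont (T : topologicalType) (F : T -> C) :=
  continuous (fun x => complex.Re (F x)) /\
  continuous (fun x => complex.Im (F x)).

Section Ccont.
Context {T : topologicalType}.
Implicit Types F G : T -> C.

Lemma ccont_real (f : T -> R) : continuous f -> ccont (fun x => (f x)%:C%C).
Proof. by move=> cf; split => //; exact: cst_continuous. Qed.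

Lemma ccont_cst (c : C) : ccont (fun _ : T => c).
Proof. by split; exact: cst_continuous. Qed.

Lemma ccontD F G : ccont F -> ccont G -> ccont (fun x => F x + G x).
Proof.
move=> [rF iF] [rG iG]; split; [under eq_fun do rewrite ReD|under eq_fun do rewrite ImD].
  by move=> x; apply: cvgD; [exact: rF|exact: rG].
by move=> x; apply: cvgD; [exact: iF|exact: iG].
Qed.

Lemma ccontM F G : ccont F -> ccont G -> ccont (fun x => F x * G x).
Proof.
move=> [rF iF] [rG iG]; split; [under eq_fun do rewrite ReM|under eq_fun do rewrite ImM].
  by move=> x; apply: cvgB; apply: cvgM; [exact: rF|exact: rG|exact: iF|exact: iG].
by move=> x; apply: cvgD; apply: cvgM; [exact: rF|exact: iG|exact: iF|exact: rG].
Qed.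

Lemma Re_conjc z : complex.Re (conjc z) = complex.Re z. Proof. by case: z. Qed.

Lemma Im_conjc z : complex.Im (conjc z) = - complex.Im z. Proof. by case: z. Qed.

Lemma ccont_conj F : ccont F -> ccont (fun x => conjc (F x)).
Proof.
move=> [rF iF]; split.
  by under eq_fun do rewrite Re_conjc.
under eq_fun do rewrite Im_conjc.
by move=> x; apply: cvgN; exact: iF.
Qed.

Lemma ccont_sum (I : Type) (s : seq I) (F : I -> T -> C) :
  (forall i, ccont (F i)) -> ccont (fun x => \sum_(i <- s) F i x).
Proof.
move=> cF; elim: s => [|i s IH].
  by under eq_fun do rewrite big_nil; exact: ccont_cst.
by under eq_fun do rewrite big_cons; exact: ccontD.
Qed.

Lemma ccont_prod (I : Type) (s : seq I) (F : I -> T -> C) :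
  (forall i, ccont (F i)) -> ccont (fun x => \prod_(i <- s) F i x).
Proof.
move=> cF; elim: s => [|i s IH].
  by under eq_fun do rewrite big_nil; exact: ccont_cst.
by under eq_fun do rewrite big_cons; exact: ccontM.
Qed.

Lemma ccont_horner F (p : {poly C}) : ccont F -> ccont (fun x => p.[F x]).
Proof.
move=> cF; elim/poly_ind: p => [|p c IH].
  by under eq_fun do rewrite horner0; exact: ccont_cst.
under eq_fun do rewrite hornerMXaddC.
by apply: ccontD; [exact: ccontM|exact: ccont_cst].
Qed.

Lemma ccont_cn F : ccont F -> continuous (fun x => cn (F x)).
Proof.
move=> [rF iF].
have E z : cn z = Num.sqrt (complex.Re z ^+ 2 + complex.Im z ^+ 2) by case: z.
under eq_fun do rewrite E.
move=> x; apply: (@cvg_comp _ _ _ _ Num.sqrt); last exact: sqrt_continuous.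
apply: cvgD.
  apply: (@cvg_comp _ _ _ _ (fun r : R => r ^+ 2)); first exact: rF.
  exact: exprn_continuous.
apply: (@cvg_comp _ _ _ _ (fun r : R => r ^+ 2)); first exact: iF.
exact: exprn_continuous.
Qed.

Lemma ccont_compact_bounded (K : set T) F : compact K -> ccont F ->
  exists2 M : R, 0 < M & forall x, K x -> cn (F x) <= M.
Proof.
move=> cK cF; have [->|/set0P K0] := eqVneq K set0; first by exists 1.
have [c _ Fc] : exists2 c, c \in K & forall t, t \in K -> cn (F t) <= cn (F c).
  apply: (@compact_EVT_max _ _ (fun x => cn (F x))) => //.
  by apply: continuous_subspaceT; exact: ccont_cn.
exists (cn (F c) + 1); first by rewrite ltr_wpDl// cn_ge0.
by move=> x Kx; apply: ler_wpDr => //; apply: Fc; exact/mem_set.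
Qed.

End Ccont.

Lemma ccont_comp (T U : topologicalType) (F : T -> C) (g : U -> T) :
  ccont F -> continuous g -> ccont (fun x => F (g x)).
Proof.
move=> [rF iF] cg; split => x.
  by apply: (@cvg_comp _ _ _ g (fun y => complex.Re (F y))); [exact: cg|exact: rF].
by apply: (@cvg_comp _ _ _ g (fun y => complex.Im (F y))); [exact: cg|exact: iF].
Qed.

(** These two properties stand for integration against [mu] until its support is examined. The bound
    looks at [K] only, so approximations need to be good only there. *)
Definition bounded_functional (T : topologicalType) (K : set T)
    (E : (T -> C) -> C) :=
  (forall c F G, ccont F -> ccont G ->
     E (fun x => c * F x + G x) = c * E F + E G) /\
  exists2 M : R, 0 <= M & forall F (B : R), ccont F -> 0 <= B ->
     (forall x, K x -> cn (F x) <= B) -> cn (E F) <= M * B.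

Section BoundedFunctional.
Context {T : topologicalType} {K : set T} {E : (T -> C) -> C}.
Hypothesis bE : bounded_functional K E.

Lemma bfun0 : E (fun=> 0) = 0.
Proof.
have := bE.1 1 _ _ (ccont_cst 0) (ccont_cst 0).
have -> : (fun _ : T => 1 * 0 + 0 : C) = (fun=> 0).
  by apply/funext => x; rewrite mulr0 addr0.
by rewrite mul1r => /eqP; rewrite addrC -subr_eq subrr eq_sym => /eqP.
Qed.

Lemma bfunZ c F : ccont F -> E (fun x => c * F x) = c * E F.
Proof.
move=> cF; have := bE.1 c _ _ cF (ccont_cst 0).
rewrite bfun0 addr0 => <-; congr E; apply/funext => x; by rewrite addr0.
Qed.

Lemma bfunD F G : ccont F -> ccont G -> E (fun x => F x + G x) = E F + E G.
Proof.
move=> cF cG; have := bE.1 1 _ _ cF cG; rewrite mul1r => <-.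
by congr E; apply/funext => x; rewrite mul1r.
Qed.

Lemma bfun_sum (I : Type) (s : seq I) (c : I -> C) (F : I -> T -> C) :
  (forall i, ccont (F i)) ->
  E (fun x => \sum_(i <- s) c i * F i x) = \sum_(i <- s) c i * E (F i).
Proof.
move=> cF; elim: s => [|i s IH].
  by under eq_fun do rewrite big_nil; rewrite big_nil bfun0.
under eq_fun do rewrite big_cons.
rewrite big_cons -IH bE.1//; apply: ccont_sum => j.
by apply: ccontM => //; exact: ccont_cst.
Qed.

Lemma bfun_eq0 F : ccont F -> (forall e : R, 0 < e -> exists2 G, ccont G /\ E G = 0 &
  forall x, K x -> cn (F x - G x) <= e) -> E F = 0.
Proof.
move=> cF FG; apply: cn0_eq0; apply/eqP; rewrite eq_le cn_ge0 andbT.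
apply/ler_addgt0Pr => e e0; rewrite add0r.
have [M M0 EM] := bE.2.
have M1 : 0 < M + 1 by lra.
have [G [cG EG0] GF] := FG _ (divr_gt0 e0 M1).
have -> : E F = E (fun x => F x + (-1) * G x).
  rewrite bfunD//; first by rewrite bfunZ// EG0 mulr0 addr0.
  by apply: ccontM => //; exact: ccont_cst.
apply: le_trans (EM _ (e / (M + 1)) _ _ _) _.
- by apply: ccontD => //; apply: ccontM => //; exact: ccont_cst.
- by rewrite divr_ge0// ltW.
- by move=> x Kx; rewrite mulN1r GF.
- by rewrite mulrCA ler_piMr 1?ltW// ltr_pdivrMr// mul1r ltrDl.
Qed.

End BoundedFunctional.
End ComplexContinuity.

(** * Tensor powers of a functional *)

Section Tensors.
Context {R : realType} {T : topologicalType}.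
Variables (K : set T) (E : (T -> R[i]) -> R[i]) (N : nat) (x0 : T).
Hypothesis bE : bounded_functional K E.
Local Notation C := R[i].
Implicit Types (F G : ('I_N -> T) -> C) (v w : C).

(* [tensor_value F v]: the N-fold tensor power of the functional [E] takes the
   value [v] at [F]; [tensor_value_bound] makes [v] unique. *)
Definition tensor_value F v :=
  exists (I : finType) (c : I -> C) (f : I -> 'I_N -> T -> C),
    [/\ forall k i, ccont (f k i),
        forall x, F x = \sum_k c k * \prod_i f k i (x i)
      & v = \sum_k c k * \prod_i E (f k i)].

(* The variables are integrated one at a time: those in [s] already are. *)
Lemma tensor_value_bound : exists2 M : R, 0 <= M & forall F v (B : R),
  tensor_value F v -> 0 <= B ->
  (forall x, (forall i, K (x i)) -> cn (F x) <= B) -> cn v <= M * B.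
Proof.
have [M M0 EM] := bE.2; exists (M ^+ N); first exact: exprn_ge0.
move=> F v B [I [c [f [cf Ff ->]]]] B0 FB.
have key (s : seq 'I_N) : uniq s -> forall x, (forall i, i \notin s -> K (x i)) ->
    cn (\sum_k c k * \prod_i (if i \in s then E (f k i) else f k i (x i)))
    <= M ^+ size s * B.
  elim: s => [_ x Kx|j s IH /= /andP[js us] x Kx].
    by rewrite /= expr0 mul1r -Ff; apply: FB => i; exact: Kx.
  pose y t i := if i == j then t else x i.
  pose a k := c k * \prod_(i | i != j) (if i \in s then E (f k i) else f k i (x i)).
  have -> : \sum_k c k * \prod_i (if i \in j :: s then E (f k i) else f k i (x i))
      = E (fun t => \sum_k a k * f k j t).
    rewrite (bfun_sum bE)//; apply: eq_bigr => k _.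
    rewrite (bigD1 j)//= mem_head mulrCA mulrC; congr (_ * _ * _).
    by apply: eq_bigr => i ij; rewrite inE (negbTE ij).
  rewrite exprS -mulrA; apply: EM.
  - by apply: ccont_sum => k; apply: ccontM => //; exact: ccont_cst.
  - by rewrite mulr_ge0// exprn_ge0.
  move=> t Kt; have := IH us (y t).
  have -> : \sum_k c k * \prod_i (if i \in s then E (f k i) else f k i (y t i)) =
      \sum_k a k * f k j t.
    apply: eq_bigr => k _; rewrite (bigD1 j)//= (negbTE js) {1}/y eqxx.
    rewrite mulrCA mulrC; congr (_ * _ * _).
    by apply: eq_bigr => i ij; rewrite /y (negbTE ij).
  apply=> i nis; rewrite /y; case: eqP => // /eqP ij; apply: Kx.
  by rewrite inE negb_or ij.
(* Once every coordinate is integrated nothing depends on [x], so [x0] serves as a placeholder and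
   may lie outside [K]. *)
have := key (enum 'I_N) (enum_uniq _) (fun=> x0).
rewrite size_enum_ord.
have -> : \sum_k c k * \prod_i (if i \in enum 'I_N then E (f k i) else f k i x0) =
    \sum_k c k * \prod_i E (f k i).
  by apply: eq_bigr => k _; congr (_ * _); apply: eq_bigr => i _; rewrite mem_enum.
by apply => i; rewrite mem_enum.
Qed.

Lemma tensor_value0 : tensor_value (fun=> 0) 0.
Proof.
exists 'I_0, (fun=> 0), (fun _ _ _ => 0).
by split => [k i|x|]; rewrite ?big_ord0//; exact: ccont_cst.
Qed.

Lemma tensor_valueD F G v w : tensor_value F v -> tensor_value G w ->
  tensor_value (fun x => F x + G x) (v + w).
Proof.
move=> [I [c [f [cf Ff ->]]]] [J [d [g [cg Gg ->]]]].
exists (I + J)%type, (fun k => match k with inl k => c k | inr k => d k end),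
  (fun k => match k with inl k => f k | inr k => g k end); split.
- by case.
- by move=> x; rewrite big_sumType/= Ff Gg.
- by rewrite big_sumType.
Qed.

Lemma tensor_valueZ a F v : tensor_value F v ->
  tensor_value (fun x => a * F x) (a * v).
Proof.
move=> [I [c [f [cf Ff ->]]]]; exists I, (fun k => a * c k), f; split => //.
- by move=> x; rewrite Ff mulr_sumr; apply: eq_bigr => k _; rewrite mulrA.
- by rewrite mulr_sumr; apply: eq_bigr => k _; rewrite mulrA.
Qed.

Lemma tensor_value_sum (I : Type) (s : seq I) (F : I -> ('I_N -> T) -> C) (v : I -> C) :
  (forall k, tensor_value (F k) (v k)) ->
  tensor_value (fun x => \sum_(k <- s) F k x) (\sum_(k <- s) v k).
Proof.
move=> Fv; elim: s => [|k s IH].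
  by under eq_fun do rewrite big_nil; rewrite big_nil; exact: tensor_value0.
by under eq_fun do rewrite big_cons; rewrite big_cons; exact: tensor_valueD.
Qed.

Lemma tensor_value_prod (f : 'I_N -> T -> C) : (forall i, ccont (f i)) ->
  tensor_value (fun x => \prod_i f i (x i)) (\prod_i E (f i)).
Proof.
move=> cf; exists 'I_1, (fun=> 1), (fun=> f).
by split=> // [x|]; rewrite big_ord1 mul1r.
Qed.

Variable zeta : T -> C.
Hypothesis czeta : ccont zeta.

(** Polynomials in the [zeta (x i)] without conjugates, kept as sums of products of one-variable
    factors so that the tensor power can be evaluated on them. *)
Definition analytic_tensor F :=
  exists (I : finType) (c : I -> C) (p : I -> 'I_N -> {poly C}),
    forall x, F x = \sum_k c k * \prod_i (p k i).[zeta (x i)].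

Lemma analytic_tensorM F G : analytic_tensor F -> analytic_tensor G ->
  analytic_tensor (fun x => F x * G x).
Proof.
move=> [I [c [p Fp]]] [J [d [q Gq]]].
exists (I * J)%type, (fun k => c k.1 * d k.2), (fun k i => p k.1 i * q k.2 i) => x.
rewrite Fp Gq big_distrlr/= pair_bigA/=; apply: eq_bigr => k _.
rewrite mulrACA; congr (_ * _); rewrite -big_split/=.
by apply: eq_bigr => i _; rewrite hornerM.
Qed.

Lemma analytic_tensor_prod (p : {poly C}) :
  analytic_tensor (fun x => \prod_i p.[zeta (x i)]).
Proof. by exists 'I_1, (fun=> 1), (fun _ _ => p) => x; rewrite big_ord1 mul1r. Qed.

Lemma analytic_tensor_cst c : analytic_tensor (fun=> c).
Proof.
exists 'I_1, (fun=> c), (fun _ _ => 1) => x; rewrite big_ord1 big1 ?mulr1// => i _.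
by rewrite hornerC.
Qed.

Hypothesis detE0 : forall p q : 'I_N -> {poly C},
  \det (\matrix_(i, j) E (fun x => (p i).[zeta x] * conjc (q j).[zeta x])) = 0.

(* Averaging [G] over the symmetric group turns it into a combination of
   determinants [det (q_j (zeta x_i))]. *)
Lemma antisymmetric_tensor_value F G : analytic_tensor F -> analytic_tensor G ->
  (forall (s : {perm 'I_N}) x, G (x \o s) = (-1) ^+ s * G x) ->
  tensor_value (fun x => F x * conjc (G x)) 0.
Proof.
move=> [I [c [p Fp]]] [J [d [q Gq]]] aG.
have fact0 : (#|{perm 'I_N}|%:R : C) != 0.
  by rewrite pnatr_eq0 -lt0n; apply/card_gt0P; exists 1%g.
have avg x : G x = (#|{perm 'I_N}|%:R)^-1 *
    \sum_(s : {perm 'I_N}) (-1) ^+ s * G (x \o (s^-1)%g).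
  under eq_bigr do rewrite aG odd_permV mulrA -signr_addb addbb mul1r.
  by rewrite sumr_const -(mulr_natl (G x)) mulKf.
have expand x : F x * conjc (G x) = (#|{perm 'I_N}|%:R)^-1 *
    \sum_k c k * (\sum_l conjc (d l) * (\sum_(s : {perm 'I_N}) (-1) ^+ s *
      \prod_i ((p k i).[zeta (x i)] * conjc (q l (s i)).[zeta (x i)]))).
  rewrite avg rmorphM /= fmorphV /= rmorph_nat mulrCA; congr (_ * _).
  rewrite Fp mulr_suml; apply: eq_bigr => k _; rewrite -mulrA; congr (_ * _).
  under [RHS]eq_bigr do rewrite mulr_sumr.
  rewrite exchange_big /= rmorph_sum mulr_sumr; apply: eq_bigr => s _.
  rewrite Gq rmorphM /= rmorph_sign rmorph_sum /= mulrCA !mulr_sumr.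
  apply: eq_bigr => l _; rewrite rmorphM /= rmorph_prod /=.
  have -> : \prod_i ((p k i).[zeta (x i)] * conjc (q l (s i)).[zeta (x i)]) =
      (\prod_i (p k i).[zeta (x i)]) *
      (\prod_i conjc (q l i).[zeta (x ((s^-1)%g i))]).
    rewrite big_split /=; congr (_ * _).
    by rewrite [RHS](reindex_inj (@perm_inj _ s)) /=; apply: eq_bigr => i _; rewrite permK.
  by rewrite [in RHS]mulrCA; congr (_ * _); rewrite mulrCA.
rewrite (funext expand) {expand avg}.
(* Zero is rewritten in the shape of the expansion with [E] applied to each factor; every sum over
   [s] is then a determinant from [detE0]. *)
rewrite [X in tensor_value _ X](_ : 0 = (#|{perm 'I_N}|%:R)^-1 *
    \sum_k c k * (\sum_l conjc (d l) * (\sum_(s : {perm 'I_N}) (-1) ^+ s *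
      \prod_i E (fun x => (p k i).[zeta x] * conjc (q l (s i)).[zeta x])))); last first.
  rewrite big1 ?mulr0// => k _; rewrite big1 ?mulr0// => l _.
  rewrite (_ : \sum_s _ = 0) ?mulr0//; apply: etrans (detE0 (p k) (q l)).
  by apply: eq_bigr => s _; congr (_ * _); apply: eq_bigr => i _; rewrite mxE.
apply: tensor_valueZ; apply: tensor_value_sum => k; apply: tensor_valueZ.
apply: tensor_value_sum => l; apply: tensor_valueZ.
apply: tensor_value_sum => s; apply: tensor_valueZ.
apply: (@tensor_value_prod (fun i x => (p k i).[zeta x] * conjc (q l (s i)).[zeta x])).
by move=> i; apply: ccontM; [|apply: ccont_conj]; exact: ccont_horner.
Qed.

End Tensors.

(** * Luecking's theorem *)

Lemma poly_horner_ext (F : numFieldType) (p q : {poly F}) :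
  (forall x, p.[x] = q.[x]) -> p = q.
Proof.
move=> pq; apply/eqP; rewrite -subr_eq0; apply: contrapT => /negP d0.
have := max_poly_roots d0 (rs := [seq k%:R | k <- iota 0 (size (p - q))]).
rewrite size_map size_iota ltnn => H; suff: false by []; apply: H; last first.
  by rewrite map_inj_uniq ?iota_uniq// => i j /eqP; rewrite eqr_nat => /eqP.
by apply/allP => x _; rewrite rootE hornerD hornerN pq subrr.
Qed.

Lemma det_row_permute (S : comPzRingType) N (M : 'I_N -> 'I_N -> S) (s : {perm 'I_N}) :
  \det (\matrix_(i, j) M (s i) j) = (-1) ^+ s * \det (\matrix_(i, j) M i j).
Proof.
rewrite -det_perm -det_mulmx -row_permE; congr (\det _).
by apply/matrixP => i j; rewrite !mxE.
Qed.

(** A continuous substitute for [1 / w]: it is defined where [w] vanishes, and its product with [w]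
    is close to 1 where [w ^+ 2] is large compared with [d]. *)
Lemma continuous_regularized_inverse (R : realType) (T : topologicalType)
    (w : T -> R) (d : R) : 0 < d -> continuous w ->
  continuous (fun x => w x / (w x ^+ 2 + d)).
Proof.
move=> d0 cw x; apply: cvgM; first exact: cw.
apply: cvgV; first by rewrite gt_eqF// ltr_wpDl// sqr_ge0.
apply: cvgD; last exact: cvg_cst.
apply: (@cvg_comp _ _ _ _ (fun r : R => r ^+ 2)); first exact: cw.
exact: exprn_continuous.
Qed.

(** * Uniform approximation by symmetric polynomials in [zeta] and their conjugates *)

Section SymmetricAlgebra.
Context {R : realType} {T : topologicalType} {N : nat}.
Variables (K : set T) (zeta : T -> R[i]).
Hypotheses (cK : compact K) (czeta : ccont zeta).
Local Notation C := R[i].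
Local Notation X := (prod_topology (fun _ : 'I_N => T)).
Implicit Types (a b : X -> C).

Definition symmetric_fun (F : ('I_N -> T) -> C) :=
  forall (s : {perm 'I_N}) x, F (x \o s) = F x.

(** [P k] and [Q k] are symmetric separately, so that multiplying a term by [|V|^2] turns both
    factors into antisymmetric ones, to which the determinant identity applies. *)
Definition symmetric_algebra a :=
  exists (I : finType) (P Q : I -> ('I_N -> T) -> C),
    (forall k, [/\ analytic_tensor zeta (P k), symmetric_fun (P k),
                   analytic_tensor zeta (Q k) & symmetric_fun (Q k)]) /\
    forall x, a x = \sum_k P k x * conjc (Q k x).

Let salg_cst c : symmetric_algebra (fun=> c).
Proof.
exists 'I_1, (fun _ _ => c), (fun _ _ => 1); split.
  by move=> k; split => //; exact: analytic_tensor_cst.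
by move=> x; rewrite big_ord1 conjc1 mulr1.
Qed.

Let salg_add a b : symmetric_algebra a -> symmetric_algebra b ->
  symmetric_algebra (fun x => a x + b x).
Proof.
move=> [I [P [Q [PQ aE]]]] [J [P' [Q' [PQ' bE]]]].
exists (I + J)%type, (fun k => match k with inl k => P k | inr k => P' k end),
  (fun k => match k with inl k => Q k | inr k => Q' k end).
by split=> [[]//|x]; rewrite big_sumType/= aE bE.
Qed.

Let salg_mul a b : symmetric_algebra a -> symmetric_algebra b ->
  symmetric_algebra (fun x => a x * b x).
Proof.
move=> [I [P [Q [PQ aE]]]] [J [P' [Q' [PQ' bE]]]].
exists (I * J)%type, (fun k x => P k.1 x * P' k.2 x), (fun k x => Q k.1 x * Q' k.2 x).
split=> [[k l]|x] /=.
  have [aP sP aQ sQ] := PQ k; have [aP' sP' aQ' sQ'] := PQ' l.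
  by split; [exact: analytic_tensorM|move=> s x; rewrite sP sP'|
             exact: analytic_tensorM|move=> s x; rewrite sQ sQ'].
rewrite aE bE big_distrlr/= pair_bigA/=; apply: eq_bigr => k _.
by rewrite rmorphM mulrACA.
Qed.

Let salg_conj a : symmetric_algebra a -> symmetric_algebra (fun x => conjc (a x)).
Proof.
move=> [I [P [Q [PQ aE]]]]; exists I, Q, P; split=> [k|x].
  by have [] := PQ k.
rewrite aE rmorph_sum; apply: eq_bigr => k _.
by rewrite rmorphM /= conjcK mulrC.
Qed.

Let ccont_analytic F : analytic_tensor zeta F -> ccont (F : X -> C).
Proof.
move=> [I [c [p FE]]]; rewrite (funext FE : F = _).
apply: ccont_sum => k; apply: ccontM; first exact: ccont_cst.
apply: ccont_prod => i; apply: ccont_horner.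
apply: (ccont_comp (g := fun x : X => x i)) => //.
exact: (@proj_continuous _ (fun _ : 'I_N => T) i).
Qed.

Let ccont_salg a : symmetric_algebra a -> ccont a.
Proof.
move=> [I [P [Q [PQ aE]]]]; rewrite (funext aE).
apply: ccont_sum => k; have [aP _ aQ _] := PQ k.
by apply: ccontM; [|apply: ccont_conj]; exact: ccont_analytic.
Qed.

(** The algebra is closed under conjugation, so its real-valued members contain all real and
    imaginary parts; the real Stone-Weierstrass theorem is applied to them. *)
Let salgR (r : X -> R) := symmetric_algebra (fun x => (r x)%:C%C).

Let salgR_Re a : symmetric_algebra a -> salgR (fun x => complex.Re (a x)).
Proof.
move=> sa; rewrite /salgR (_ : (fun x => _) =
  (fun x => (2^-1)%:C%C * (a x + conjc (a x)))).
  by apply: salg_mul; [exact: salg_cst|apply: salg_add => //; exact: salg_conj].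
apply/funext => x; case: (a x) => u v; apply/eqP; rewrite eq_complex /=.
by apply/andP; split; apply/eqP; field.
Qed.

Let salgR_Im a : symmetric_algebra a -> salgR (fun x => complex.Im (a x)).
Proof.
move=> sa; rewrite /salgR (_ : (fun x => _) =
  (fun x => (complex.Re (Complex 0 (-1) * a x))%:C%C)).
  by apply: salgR_Re; apply: salg_mul.
apply/funext => x; case: (a x) => u v; congr (_%:C)%C => /=; ring.
Qed.

(** For each [c] the product of the [c - zeta (x i)] is a symmetric member of the algebra. Together
    these values determine the monic polynomial with roots [zeta (x i)], hence the roots with
    multiplicity. *)
Let salgR_separates (x y : X) : (forall r, salgR r -> r x = r y) ->
  exists s : {perm 'I_N}, forall i, zeta (x i) = zeta (y (s i)).
Proof.
move=> rxy.
have axy a : symmetric_algebra a -> a x = a y.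
  move=> sa; have := rxy _ (salgR_Re sa); have := rxy _ (salgR_Im sa).
  by case: (a x) (a y) => [u v] [u' v'] /= -> ->.
pose z (x : X) := [tuple zeta (x i) | i < N].
have zE (w : X) : \prod_(c <- z w) ('X - c%:P) = \prod_(i < N) ('X - (zeta (w i))%:P).
  by rewrite big_map big_enum.
have /prod_XsubC_eq/tuple_permP[s zxy] :
    \prod_(c <- z x) ('X - c%:P) = \prod_(c <- z y) ('X - c%:P).
  apply: poly_horner_ext => c; rewrite !zE !horner_prod.
  under eq_bigr do rewrite hornerXsubC.
  under [RHS]eq_bigr do rewrite hornerXsubC.
  have pE (w : X) : \prod_(i < N) (c - zeta (w i)) =
      \prod_(i < N) (c%:P - 'X).[zeta (w i)].
    by apply: eq_bigr => i _; rewrite hornerD hornerN hornerC hornerX.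
  rewrite !pE; apply: (axy (fun w => \prod_(i < N) (c%:P - 'X).[zeta (w i)])).
  exists 'I_1, (fun _ w => \prod_i (c%:P - 'X).[zeta (w i)]), (fun _ _ => 1).
  split=> [_|w]; last by rewrite big_ord1 conjc1 mulr1.
  split => //; [exact: analytic_tensor_prod|move=> s w|exact: analytic_tensor_cst].
  by rewrite [RHS](reindex_inj (@perm_inj _ s)).
exists s => i.
have /(congr1 (fun t => tnth t i)) : z x = [tuple tnth (z y) (s i) | i < N].
  exact: val_inj.
by rewrite !tnth_mktuple.
Qed.

Definition vandermonde (x : 'I_N -> T) : C :=
  \det (\matrix_(i, j) zeta (x i) ^+ (j : 'I_N)).

Lemma vandermonde_antisym (s : {perm 'I_N}) x :
  vandermonde (x \o s) = (-1) ^+ s * vandermonde x.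
Proof. exact: (det_row_permute (fun i j => zeta (x i) ^+ (j : 'I_N))). Qed.

Lemma analytic_vandermonde : analytic_tensor zeta vandermonde.
Proof.
exists {perm 'I_N}, (fun s : {perm 'I_N} => (-1) ^+ s),
  (fun (s : {perm 'I_N}) i => 'X^(s i)) => x.
by apply: eq_bigr => s _; congr (_ * _); apply: eq_bigr => i _; rewrite mxE hornerXn.
Qed.

Lemma vandermonde_eq0 x : vandermonde x = 0 ->
  exists i j : 'I_N, i != j /\ zeta (x i) = zeta (x j).
Proof.
move=> V0; have : \det (Vandermonde N (\row_i zeta (x i))) = 0.
  rewrite -[RHS]V0 -det_tr; congr (\det _); apply/matrixP => i j.
  by rewrite !mxE.
rewrite det_Vandermonde => /eqP/prodf_eq0[i _ /prodf_eq0[j ij]].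
rewrite !mxE subr_eq0 => /eqP zij; exists i, j; split => //.
by rewrite -val_eqE neq_ltn ij.
Qed.

Let KN : set X := [set x | forall i, K (x i)].

Let cKN : compact KN.
Proof. exact: (@tychonoff _ (fun _ : 'I_N => T) (fun=> K)). Qed.

Let W x := cn (vandermonde x) ^+ 2.

Let cW : continuous (W : X -> R).
Proof.
have cV : ccont (vandermonde : X -> C) by exact/ccont_analytic/analytic_vandermonde.
have cVn := ccont_cn cV.
move=> x; apply: (@cvg_comp _ _ _ _ (fun r : R => r ^+ 2)).
  exact: cVn.
exact: exprn_continuous.
Qed.

(* [|V|^2] is a uniform multiplier for symmetric functions vanishing with [V]:
   regularize the quotient [F / |V|^2] as [F |V|^2 / (|V|^4 + d)] and apply
   Stone-Weierstrass. *)
Lemma symmetric_approximation (F : X -> C) : ccont F ->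
  (forall x y (s : {perm 'I_N}), (forall i, zeta (x i) = zeta (y (s i))) -> F x = F y) ->
  (forall x, vandermonde x = 0 -> F x = 0) ->
  forall e : R, 0 < e -> exists2 a, symmetric_algebra a & forall x : X,
    (forall i, K (x i)) ->
    cn (F x - a x * (vandermonde x * conjc (vandermonde x))) <= e.
Proof.
move=> cF symF F0 e e0.
have W0 x : 0 <= W x by rewrite sqr_ge0.
(* On the compact set where [cn (F x)] is at least [e / 2], the minimum of [W] is positive, because
   [F] vanishes wherever [W] does. *)
have [eta eta0 Feta] : exists2 eta : R, 0 < eta &
    forall x, KN x -> e / 2 <= cn (F x) -> eta <= W x.
  pose D : set X := KN `&` [set x | e / 2 <= cn (F x)].
  have cD : compact D.
    apply: compact_closedI => //.
    apply: (@closed_comp _ _ (fun x => cn (F x)) [set r | e / 2 <= r]).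
      by move=> x _; exact: ccont_cn.
    exact: closed_ge.
  have [D0|/set0P D0] := eqVneq D set0.
    exists 1 => // x Kx Fx; suff : D x by rewrite D0.
    by split.
  have [c cD' Wc] : exists2 c, c \in D & forall t, t \in D -> W c <= W t.
    by apply: compact_EVT_min => //; exact: continuous_subspaceT.
  exists (W c); last by move=> x Kx Fx; apply: Wc; apply/mem_set; split.
  rewrite lt_neqAle W0 andbT eq_sym; apply/eqP => Wc0.
  have : cn (F c) = 0.
    rewrite F0 ?cn0//; apply: cn0_eq0; apply/eqP.
    by move/eqP: Wc0; rewrite /W sqrf_eq0.
  move: cD' => /set_mem[_ /= Fc] Fc0; move: Fc; rewrite Fc0; lra.
have [B B0 FB] := ccont_compact_bounded cKN cF.
have [BW BW0 WB] : exists2 M : R, 0 < M & forall x, KN x -> W x <= M.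
  have cV : ccont (vandermonde : X -> C) by apply: ccont_analytic; exact: analytic_vandermonde.
  have [M M0 VM] := ccont_compact_bounded cKN cV.
  exists (M ^+ 2); first exact: exprn_gt0.
  by move=> x Kx; apply: lerXn2r; rewrite ?nnegrE ?cn_ge0 ?(ltW M0) ?VM.
(* The regularization error is [d / (W x ^+ 2 + d)] times [F x]. Where [F x] is large, [W x] is at
   least [eta] and this [d] makes the factor at most [e / 2 / B]; elsewhere the factor is at most 1
   and [F x] is already small. *)
pose d := e / 2 * eta ^+ 2 / B.
have d0 : 0 < d by rewrite /d !mulr_gt0 ?invr_gt0 ?exprn_gt0//; lra.
have Wd x : 0 < W x ^+ 2 + d by rewrite ltr_wpDl// sqr_ge0.
pose q x := W x / (W x ^+ 2 + d).
have cq : continuous (q : X -> R).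
  exact: continuous_regularized_inverse.
pose f x := (q x)%:C%C * F x.
have [rf imf] : ccont (f : X -> C) by apply: ccontM => //; exact: ccont_real.
have symf x y : (forall r, salgR r -> r x = r y) -> f x = f y.
  move=> /salgR_separates[s xy]; rewrite /f (symF _ _ _ xy); congr ((_)%:C%C * _).
  suff WE : W x = W y by rewrite /q WE.
  have -> : W x = W ((y : 'I_N -> T) \o s).
    by rewrite /W; congr (cn (\det _) ^+ 2); apply/matrixP => i j; rewrite !mxE xy.
  rewrite /W vandermonde_antisym cnM.
  suff -> : cn ((-1) ^+ s : C) = 1 by rewrite mul1r.
  case: (odd_perm s); first by rewrite expr1 cnN; exact: ComplexField.Normc.normc1.
  by rewrite expr0; exact: ComplexField.Normc.normc1.
(* Real and imaginary parts are approximated separately, and the result is multiplied by [W], which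
   is at most [BW]; the total is [e / 2]. *)
have e1 : 0 < e / 4 / BW by rewrite !mulr_gt0 ?invr_gt0.
have swf (g : X -> R) : continuous g ->
    (forall x y, (forall r, salgR r -> r x = r y) -> g x = g y) ->
    exists2 r, salgR r & forall x, KN x -> `|g x - r x| < e / 4 / BW.
  move=> cg sg; apply: stone_weierstrass => //.
  - by move=> r /ccont_salg[].
  - by move=> c; exact: salg_cst.
  - move=> r r' sr sr'.
    rewrite /salgR (_ : (fun x => _) = (fun x => (r x)%:C%C + (r' x)%:C%C)).
      exact: salg_add.
    by apply/funext => x; rewrite rmorphD.
  - move=> r r' sr sr'.
    rewrite /salgR (_ : (fun x => _) = (fun x => (r x)%:C%C * (r' x)%:C%C)).
      exact: salg_mul.
    by apply/funext => x; rewrite rmorphM.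
  - by move=> x y _ _; exact: sg.
have [|r sr fr] := swf _ rf; first by move=> x y xy; rewrite (symf _ _ xy).
have [|r' sr' fr'] := swf _ imf; first by move=> x y xy; rewrite (symf _ _ xy).
exists (fun x => (r x)%:C%C + 'i%C * (r' x)%:C%C).
  by apply: salg_add => //; apply: salg_mul.
move=> x Kx; rewrite mul_conjc -/(W x).
pose a := (r x)%:C%C + 'i%C * (r' x)%:C%C.
rewrite -[X in cn X]/(F x - a * (W x)%:C%C).
have -> : F x - a * (W x)%:C%C =
    (F x - f x * (W x)%:C%C) + (f x - a) * (W x)%:C%C.
  by rewrite mulrBl addrA subrK.
apply: le_trans (cnD _ _) _.
have -> : F x - f x * (W x)%:C%C = (d / (W x ^+ 2 + d))%:C%C * F x.
  rewrite /f mulrAC -rmorphM -{1}(mul1r (F x)) -mulrBl -(rmorph1 (real_complex R)) -rmorphB.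
  congr ((_)%:C%C * _); rewrite /q; field; by rewrite gt_eqF.
rewrite !cnM !cn_real.
have h1 : `|d / (W x ^+ 2 + d)| * cn (F x) <= e / 2.
  rewrite ger0_norm; last by rewrite divr_ge0 ?ltW.
  have [Fx|Fx] := leP (e / 2) (cn (F x)).
    have etaW := Feta x Kx Fx.
    have h : d / (W x ^+ 2 + d) <= e / 2 / B.
      have dE : d = e / 2 / B * eta ^+ 2 by rewrite /d mulrAC.
      have eW : eta ^+ 2 <= W x ^+ 2 by apply: lerXn2r; rewrite ?nnegrE// ltW.
      rewrite ler_pdivrMr// {1}dE; apply: ler_wpM2l; last by lra.
      by rewrite !mulr_ge0 ?invr_ge0// ltW.
    apply: le_trans (ler_pM _ (cn_ge0 _) h (FB x Kx)) _; last by rewrite divfK ?gt_eqF.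
    by rewrite divr_ge0 ?ltW.
  rewrite -[leRHS]mul1r; apply: ler_pM; last exact: ltW.
  - by rewrite divr_ge0 ?ltW.
  - exact: cn_ge0.
  - by rewrite ler_pdivrMr// mul1r lerDr sqr_ge0.
have h2 : cn (f x - a) <= e / 2 / BW.
  apply: le_trans (cn_le _) _.
  have -> : complex.Re (f x - a) = complex.Re (f x) - r x.
    by rewrite /a; case: (f x) => u v /=; ring.
  have -> : complex.Im (f x - a) = complex.Im (f x) - r' x.
    by rewrite /a; case: (f x) => u v /=; ring.
  have -> : e / 2 / BW = e / 4 / BW + e / 4 / BW by field; rewrite gt_eqF.
  by rewrite lerD// ltW// ?fr ?fr'.
have h3 : cn (f x - a) * `|W x| <= e / 2.
  rewrite (ger0_norm (W0 x)).
  apply: le_trans (ler_pM (cn_ge0 _) (W0 x) h2 (WB x Kx)) _.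
  by rewrite divfK ?gt_eqF.
lra.
Qed.

End SymmetricAlgebra.

Section Luecking.
Context {R : realType} {T : topologicalType} {N : nat}.
Variables (K : set T) (E : (T -> R[i]) -> R[i]) (x0 : T) (zeta : T -> R[i]).
Hypotheses (cK : compact K) (bE : bounded_functional K E) (czeta : ccont zeta).
Local Notation C := R[i].
Local Notation X := (prod_topology (fun _ : 'I_N => T)).
Hypothesis detE0 : forall p q : 'I_N -> {poly C},
  \det (\matrix_(i, j) E (fun x => (p i).[zeta x] * conjc (q j).[zeta x])) = 0.

(** By Andreief's identity, [N!] times the determinant is the value of the tensor power at
    [F = det (u_j (x_i)) * det (h_j (x_i))]. This [F] is symmetric and vanishes with the Vandermonde
    determinant, so it is a uniform limit of functions whose value is 0. *)
Theorem luecking (u h : 'I_N -> T -> C) :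
  (forall i, ccont (u i)) -> (forall i, ccont (h i)) ->
  (forall i x y, zeta x = zeta y -> u i x = u i y) ->
  (forall i x y, zeta x = zeta y -> h i x = h i y) ->
  \det (\matrix_(i, j) E (fun x => u i x * h j x)) = 0.
Proof.
move=> cu ch fu fh.
pose D (w : 'I_N -> T -> C) (x : 'I_N -> T) := \det (\matrix_(i, j) w j (x i)).
have DE w x : D w x = \sum_(s : {perm 'I_N}) (-1) ^+ s * \prod_i w (s i) (x i).
  by apply: eq_bigr => s _; congr (_ * _); apply: eq_bigr => i _; rewrite mxE.
pose F (x : 'I_N -> T) := D u x * D h x.
set G := \matrix_(i, j) _.
have fact0 : (#|{perm 'I_N}|%:R : C) != 0.
  by rewrite pnatr_eq0 -lt0n; apply/card_gt0P; exists 1%g.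
have tF : tensor_value E F (#|{perm 'I_N}|%:R * \det G).
  have -> : #|{perm 'I_N}|%:R * \det G =
      \sum_(s : {perm 'I_N}) (-1) ^+ s * (\sum_(t : {perm 'I_N}) (-1) ^+ t *
        \prod_i E (fun x => u (s i) x * h (t i) x)).
    rewrite mulr_natl -sumr_const; apply: eq_bigr => s _.
    rewrite (_ : \sum_t _ = (-1) ^+ s * \det G).
      by rewrite mulrA -signr_addb addbb mul1r.
    have -> : G = \matrix_(i, j) G i j by apply/matrixP => i j; rewrite !mxE.
    rewrite -det_row_permute; apply: eq_bigr => t _; congr (_ * _).
    by apply: eq_bigr => i _; rewrite !mxE.
  have FE x : F x = \sum_(s : {perm 'I_N}) (-1) ^+ s * (\sum_(t : {perm 'I_N}) (-1) ^+ t *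
        \prod_i (u (s i) (x i) * h (t i) (x i))).
    rewrite /F !DE mulr_suml; apply: eq_bigr => s _; rewrite -mulrA; congr (_ * _).
    rewrite mulr_sumr; apply: eq_bigr => t _; rewrite mulrCA; congr (_ * _).
    by rewrite big_split.
  rewrite (funext FE); apply: tensor_value_sum => s; apply: tensor_valueZ.
  apply: tensor_value_sum => t; apply: tensor_valueZ.
  apply: (@tensor_value_prod _ _ E N (fun i x => u (s i) x * h (t i) x)) => i.
  exact: ccontM.
have cD w : (forall i, ccont (w i)) -> ccont (D w : X -> C).
  move=> cw; rewrite (funext (DE w) : D w = _).
  apply: ccont_sum => s; apply: ccontM; first exact: ccont_cst.
  apply: ccont_prod => i; apply: (ccont_comp (g := fun x : X => x i)) => //.
  exact: (@proj_continuous _ (fun _ : 'I_N => T) i).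
have cF : ccont (F : X -> C) by apply: ccontM; exact: cD.
have symD w (fw : forall i x y, zeta x = zeta y -> w i x = w i y)
    (x y : 'I_N -> T) (s : {perm 'I_N}) :
    (forall i, zeta (x i) = zeta (y (s i))) -> D w x = (-1) ^+ s * D w y.
  move=> xy; rewrite /D -(det_row_permute (fun i j => w j (y i))); congr (\det _).
  by apply/matrixP => i j; rewrite !mxE; exact: fw.
have symF (x y : 'I_N -> T) (s : {perm 'I_N}) :
    (forall i, zeta (x i) = zeta (y (s i))) -> F x = F y.
  move=> xy; rewrite /F (symD u fu _ _ _ xy) (symD h fh _ _ _ xy).
  by rewrite mulrACA -signr_addb addbb mul1r.
have F0 x : vandermonde zeta x = 0 -> F x = 0.
  move=> /vandermonde_eq0[i [j [ij zij]]]; rewrite /F /D.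
  rewrite (@determinant_alternate _ _ _ i j)// ?mul0r// => k.
  by rewrite !mxE; exact: fu.
have [M M0 tb] := tensor_value_bound N x0 bE.
suff : #|{perm 'I_N}|%:R * \det G = 0.
  by move/eqP; rewrite mulf_eq0 (negbTE fact0) => /eqP.
apply: cn0_eq0; apply/eqP; rewrite eq_le cn_ge0 andbT.
apply/ler_addgt0Pr => e e0; rewrite add0r.
have M1 : 0 < M + 1 by lra.
have [a [I [P [Q [PQ aE]]]] Fa] :=
  symmetric_approximation cK czeta cF symF F0 (divr_gt0 e0 M1).
apply: le_trans (tb (fun x => F x +
    (-1) * (a x * (vandermonde zeta x * conjc (vandermonde zeta x)))) _ (e / (M + 1)) _ _ _) _.
- rewrite -[X in tensor_value _ _ X]addr0; apply: tensor_valueD => //.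
  rewrite -(mulr0 (-1)); apply: tensor_valueZ.
  have aVE x : a x * (vandermonde zeta x * conjc (vandermonde zeta x)) =
      \sum_k (P k x * vandermonde zeta x) * conjc (Q k x * vandermonde zeta x).
    by rewrite aE mulr_suml; apply: eq_bigr => k _; rewrite rmorphM mulrACA.
  rewrite (funext aVE) [X in tensor_value _ _ X](_ : 0 = \sum_(k : I) 0); last by rewrite big1.
  apply: tensor_value_sum => k; have [aP sP aQ sQ] := PQ k.
  apply: (antisymmetric_tensor_value czeta detE0).
  + by apply: analytic_tensorM => //; exact: analytic_vandermonde.
  + by apply: analytic_tensorM => //; exact: analytic_vandermonde.
  + by move=> s x; rewrite sQ vandermonde_antisym mulrCA.
- by rewrite divr_ge0// ltW.
- by move=> x Kx; rewrite mulN1r Fa.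
- by rewrite mulrCA ler_piMr 1?ltW// ltr_pdivrMr// mul1r ltrDl.
Qed.

End Luecking.

(** * Annihilating polynomials *)

(** Otherwise every nonzero [c] is detected by some [h]. Given [k < N] independent columns, take [c]
    orthogonal to them; a column that detects [c] is independent of the others. Reaching [N] columns
    contradicts the zero determinant. Neither finiteness nor structure on [H] is involved. *)
Lemma det0_common_kernel (F : fieldType) (H : Type) N (phi : 'I_N -> H -> F) :
  (forall h : 'I_N -> H, \det (\matrix_(i, j) phi i (h j)) = 0) ->
  exists2 c : 'rV[F]_N, c != 0 & forall h, \sum_i c 0 i * phi i h = 0.
Proof.
move=> det0; apply: contrapT => nc.
have {}nc (c : 'rV[F]_N) : c != 0 -> exists h, \sum_i c 0 i * phi i h != 0.
  move=> c0; apply: contrapT => nh; apply: nc; exists c => // h.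
  by apply/eqP; apply: contrapT => /negP hc; apply: nh; exists h.
have free k : (k <= N)%N -> exists h : 'I_k -> H, forall w : 'I_k -> F,
      (forall i, \sum_j w j * phi i (h j) = 0) -> forall j, w j = 0.
  elim: k => [_|k IH kN].
    by exists (fun i : 'I_0 => False_rect H (notF (ltn_ord i))) => w _ [].
  have [h hfree] := IH (ltnW kN).
  pose A := \matrix_(i < N, j < k) phi i (h j).
  have : kermx A != 0.
    by rewrite -mxrank_eq0 mxrank_ker subn_eq0 -ltnNge (leq_ltn_trans (rank_leq_col A)).
  case/rowV0Pn => c /sub_kermxP cA /nc[h0 ch0].
  exists (fun j => if unlift ord0 j is Some j' then h j' else h0) => w w0.
  have wE i : w ord0 * phi i h0 + \sum_(j < k) w (lift ord0 j) * phi i (h j) = 0.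
    rewrite -[RHS](w0 i) big_ord_recl unlift_none; congr (_ + _).
    by apply: eq_bigr => j _; rewrite liftK.
  have wz : w ord0 = 0.
    have : \sum_i c 0 i * (w ord0 * phi i h0 +
        \sum_(j < k) w (lift ord0 j) * phi i (h j)) = 0.
      by rewrite big1// => i _; rewrite wE mulr0.
    under eq_bigr do rewrite mulrDr mulrCA mulr_sumr.
    rewrite big_split/= -mulr_sumr exchange_big/= [X in _ + X]big1 ?addr0.
      by move/eqP; rewrite mulf_eq0 (negbTE ch0) orbF => /eqP.
    move=> j _; under eq_bigr do rewrite mulrCA.
    rewrite -mulr_sumr; move/rowP: cA => /(_ j); rewrite !mxE => cj.
    rewrite (_ : \sum_i _ = 0) ?mulr0//; apply: etrans cj.
    by apply: eq_bigr => i _; rewrite !mxE.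
  have wl := hfree (fun j => w (lift ord0 j)).
  move=> j; case: (unliftP ord0 j) => [j' ->|->//]; apply: wl => i.
  by have := wE i; rewrite wz mul0r add0r.
have [g gfree] := free N (leqnn N).
move/eqP: (det0 g); rewrite -det_tr => /det0P[v v0 vA].
move/negP: v0; apply; apply/eqP/rowP => j; rewrite mxE.
apply: (gfree (fun j => v 0 j)) => i; move/rowP: vA => /(_ i).
by rewrite !mxE => vi; apply: etrans vi; apply: eq_bigr => l _; rewrite !mxE.
Qed.

Lemma separating_poly (F : fieldType) (a : F) (L : seq F) :
  exists p : {poly F}, p.[a] = 1 /\ forall b, b \in L -> b != a -> p.[b] = 0.
Proof.
pose q := \prod_(b <- L | b != a) ('X - b%:P).
have qa : q.[a] != 0.
  rewrite horner_prod prodf_seq_neq0; apply/allP => b _; apply/implyP => ba.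
  by rewrite hornerXsubC subr_eq0 eq_sym.
exists ((q.[a])^-1 *: q); rewrite hornerZ mulVf//; split => // b bL ba.
suff qb : q.[b] == 0 by rewrite hornerZ (eqP qb) mulr0.
rewrite /q horner_prod prodf_seq_eq0; apply/hasP; exists b => //.
by rewrite ba hornerXsubC subrr eqxx.
Qed.

Section Annihilators.
Context {R : realType} {T : topologicalType} {m : nat}.
Variables (K : set T) (E : (T -> R[i]) -> R[i]) (x0 : T) (zeta : T -> R[i]).
Hypotheses (cK : compact K) (bE : bounded_functional K E) (czeta : ccont zeta).
Local Notation C := R[i].
Hypothesis detE0 : forall p q : 'I_m.+1 -> {poly C},
  \det (\matrix_(i, j) E (fun x => (p i).[zeta x] * conjc (q j).[zeta x])) = 0.

(** These play the role of the continuous functions on the image plane of [zeta]. *)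
Definition fibre_fun (h : T -> C) :=
  ccont h /\ forall x y, zeta x = zeta y -> h x = h y.

(** Stronger than a vanishing integral: the push-forward under [zeta], multiplied by [Q] evaluated
    at [s], is zero. *)
Definition annihilates (s : T -> R) (Q : {poly C}) :=
  forall h, fibre_fun h -> E (fun x => Q.[(s x)%:C%C] * h x) = 0.

Lemma fibre_funM g h : fibre_fun g -> fibre_fun h -> fibre_fun (fun x => g x * h x).
Proof.
move=> [cg fg] [ch fh]; split; first exact: ccontM.
by move=> x y xy; rewrite (fg _ _ xy) (fh _ _ xy).
Qed.

Section OneFunction.
Variable s : T -> R.
Hypotheses (cs : continuous s) (fs : forall x y, zeta x = zeta y -> s x = s y).

Lemma fibre_fun_horner (p : {poly C}) : fibre_fun (fun x => p.[(s x)%:C%C]).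
Proof.
split; first by apply: ccont_horner; exact: ccont_real.
by move=> x y /fs ->.
Qed.

(** The powers [1, s, ..., s^m] are [m + 1] functions all of whose determinants against fibre
    functions vanish, so one combination of them is killed. The size bound means degree at most [m],
    which later limits the number of atoms. *)
Lemma annihilating_poly : exists Q : {poly C},
  [/\ Q != 0, (size Q <= m.+1)%N & annihilates s Q].
Proof.
pose phi (i : 'I_m.+1) (h : {h | fibre_fun h}) :=
  E (fun x => ('X^i).[(s x)%:C%C] * sval h x).
have [|c c0 cphi] := @det0_common_kernel _ _ _ phi.
  move=> h; apply: (luecking x0 cK bE czeta detE0) => i.
  - by have [] := fibre_fun_horner 'X^i.
  - by have [] := svalP (h i).
  - by have [] := fibre_fun_horner 'X^i.
  - by have [] := svalP (h i).
exists (\poly_(i < m.+1) c 0 (inord i)); split; last first.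
- move=> h fh; have := cphi (exist _ h fh); rewrite /phi /=.
  rewrite -(bfun_sum bE); last first.
    by move=> i; apply: ccontM; [have [] := fibre_fun_horner 'X^i|exact: fh.1].
  move=> <-; congr E; apply/funext => x.
  rewrite horner_poly mulr_suml; apply: eq_bigr => i _.
  by rewrite inord_val hornerXn mulrA.
- exact: size_poly.
apply: contra c0 => /eqP/polyP Q0; apply/eqP/rowP => i; rewrite mxE.
by have := Q0 i; rewrite coef_poly ltn_ord inord_val coef0.
Qed.

(** Since [s] is real, [s - z] has no zero and [1 / (s - z)] is a fibre function; it is absorbed
    into the test function. *)
Lemma annihilates_nonreal (Q : {poly C}) (z : C) : complex.Im z != 0 ->
  annihilates s (Q * ('X - z%:P)) -> annihilates s Q.
Proof.
move=> z0 QE h fh.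
have den0 x : 0 < (s x - complex.Re z) ^+ 2 + complex.Im z ^+ 2.
  by rewrite ltr_wpDl ?sqr_ge0// exprn_even_gt0.
pose inv x := ((s x - complex.Re z) ^+ 2 + complex.Im z ^+ 2)^-1.
pose g x := (inv x)%:C%C * conjc ((s x)%:C%C - z).
have fg : fibre_fun g.
  split; last by move=> x y /fs xy; rewrite /g /inv xy.
  apply: ccontM.
    apply: ccont_real => x; apply: cvgV; first by rewrite gt_eqF.
    apply: cvgD; last exact: cvg_cst.
    apply: (@cvg_comp _ _ _ _ (fun r : R => r ^+ 2)); last exact: exprn_continuous.
    by apply: cvgB; [exact: cs|exact: cvg_cst].
  by apply: ccont_conj; apply: ccontD; [exact: ccont_real|exact: ccont_cst].
rewrite -[RHS](QE _ (fibre_funM fg fh)); congr E; apply/funext => x.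
rewrite hornerM hornerXsubC -mulrA; congr (_ * _).
rewrite mulrA /g mulrCA mul_conjc -rmorphM/= cn_sqr.
suff -> : inv x * (complex.Re ((s x)%:C%C - z) ^+ 2 + complex.Im ((s x)%:C%C - z) ^+ 2) = 1.
  by rewrite mul1r.
have -> : complex.Re ((s x)%:C%C - z) = s x - complex.Re z by case: (z).
have -> : complex.Im ((s x)%:C%C - z) = - complex.Im z by case: (z) => a b /=; ring.
by rewrite sqrrN mulVf// gt_eqF.
Qed.

(** A functional bounded by suprema cannot contain derivatives of point masses. With [r = s - t],
    the function [r] is approximated by [r^2 * g], where [g = r / (r^2 + d^2)]; the error is at most
    [d], whence [d = e / B]. *)
Lemma annihilates_double (Q : {poly C}) (t : R) :
  annihilates s (Q * ('X - (t%:C%C)%:P) ^+ 2) -> annihilates s (Q * ('X - (t%:C%C)%:P)).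
Proof.
move=> QE h fh.
have cF : ccont (fun x => Q.[(s x)%:C%C] * h x).
  by apply: ccontM; [have [] := fibre_fun_horner Q|exact: fh.1].
have [B B0 QB] := ccont_compact_bounded cK cF.
apply: (bfun_eq0 bE).
  by apply: ccontM; [have [] := fibre_fun_horner (Q * ('X - (t%:C%C)%:P))|exact: fh.1].
move=> e e0; pose d := e / B.
have d0 : 0 < d by rewrite divr_gt0.
have den0 x : 0 < (s x - t) ^+ 2 + d ^+ 2 by rewrite ltr_wpDl ?sqr_ge0// exprn_gt0.
pose g x := ((s x - t) / ((s x - t) ^+ 2 + d ^+ 2))%:C%C.
have fg : fibre_fun g.
  split; last by move=> x y /fs xy; rewrite /g xy.
  apply: ccont_real; apply: (continuous_regularized_inverse (w := fun x => s x - t)).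
    exact: exprn_gt0.
  by move=> x; apply: cvgB; [exact: cs|exact: cvg_cst].
exists (fun x => (Q * ('X - (t%:C%C)%:P) ^+ 2).[(s x)%:C%C] * (g x * h x)).
  split; last by apply: QE; exact: fibre_funM.
  apply: ccontM; first by have [] := fibre_fun_horner (Q * ('X - (t%:C%C)%:P) ^+ 2).
  by have [] := fibre_funM fg fh.
move=> x Kx; rewrite !hornerM !hornerXsubC -!rmorphB/=.
move: (QB x Kx); move: (Q.[_]) (h x) => q hx qB.
have -> : q * ((s x - t)%:C)%C * hx - q * ((s x - t)%:C%C * (s x - t)%:C%C) * (g x * hx) =
    (q * hx) * ((s x - t)%:C%C - ((s x - t)%:C%C * (s x - t)%:C%C * g x)).
  rewrite mulrBr; congr (_ - _); first by rewrite mulrAC.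
  by rewrite [g x * hx]mulrC mulrACA.
rewrite -!rmorphM -rmorphB/= cnM cn_real.
move: (s x - t) (den0 x) => r r0.
have -> : r - r * r * (r / (r ^+ 2 + d ^+ 2)) = r * d ^+ 2 / (r ^+ 2 + d ^+ 2).
  by field; rewrite gt_eqF.
have -> : e = B * d by rewrite /d mulrC divfK// gt_eqF.
apply: ler_pM => //; first exact: cn_ge0.
rewrite normrM normfV (gtr0_norm r0) ler_pdivrMr// normrM (ger0_norm (sqr_ge0 d)).
have hr : `|r| ^+ 2 = r ^+ 2 by rewrite real_normK// num_real.
have h2 : 0 <= (`|r| - d) ^+ 2 by exact: sqr_ge0.
have h3 : `|r| * d <= r ^+ 2 + d ^+ 2.
  have := normr_ge0 r; rewrite -hr => hn.
  have : 0 <= `|r| * d by rewrite mulr_ge0// ltW.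
  by move: h2; rewrite sqrrB -mulr_natr; lra.
by rewrite expr2 mulrA [leRHS]mulrC ler_wpM2r// ltW.
Qed.

(* [annihilates_nonreal] and [annihilates_double] strip an annihilating
   polynomial down to one with simple real roots. *)
Lemma real_annihilator : exists t : seq R,
  uniq t /\ annihilates s (\prod_(a <- t) ('X - (a%:C%C)%:P)).
Proof.
have [Q [Q0 _ QE]] := annihilating_poly.
have [rs Qrs] := closed_field_poly_normal Q.
have rsE : annihilates s (\prod_(z <- rs) ('X - z%:P)).
  move=> h fh; have lc0 : lead_coef Q != 0 by rewrite lead_coef_eq0.
  have ch : ccont (fun x => (\prod_(z <- rs) ('X - z%:P)).[(s x)%:C%C] * h x).
    by apply: ccontM; [have [] := fibre_fun_horner (\prod_(z <- rs) ('X - z%:P))|exact: fh.1].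
  apply: (mulfI lc0); rewrite mulr0 -(bfunZ bE)// -[RHS](QE h fh).
  by congr E; apply/funext => x; rewrite {2}Qrs hornerZ mulrA.
(* [t] collects the distinct real roots met so far, and [rs'] holds the roots still to be
   treated. *)
suff key (rs' : seq C) (t : seq R) : uniq t ->
    annihilates s (\prod_(a <- t) ('X - (a%:C%C)%:P) * \prod_(z <- rs') ('X - z%:P)) ->
    exists t, uniq t /\ annihilates s (\prod_(a <- t) ('X - (a%:C%C)%:P)).
  by apply: (key rs [::]) => //; rewrite big_nil mul1r.
elim: rs' t => [|z rs' IH] t ut; first by rewrite big_nil mulr1 => ?; exists t.
rewrite big_cons mulrCA mulrC => annt.
have [z0|z0] := eqVneq (complex.Im z) 0; last first.
  exact: (IH t ut (annihilates_nonreal z0 annt)).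
have zr : z = (complex.Re z)%:C%C by case: z z0 {annt} => a b /= ->.
move: (complex.Re z) zr annt => a -> annt {z z0}.
have [at_|at_] := boolP (a \in t); last first.
  apply: (IH (a :: t)); first by rewrite /= at_.
  by rewrite big_cons -mulrA mulrC.
apply: (IH t ut); move: annt.
rewrite (perm_big _ (perm_to_rem at_))/= big_cons.
rewrite -!mulrA [X in annihilates s X]mulrC -mulrA.
rewrite [X in _ -> annihilates s X]mulrC => annt; apply: annihilates_double.
move: annt; rewrite expr2 !mulrA.
by rewrite [X in annihilates s X](_ : _ = \prod_(j <- rem a t) ('X - (j%:C%C)%:P) *
  \prod_(j <- rs') ('X - j%:P) * ('X - (a%:C%C)%:P) * ('X - (a%:C%C)%:P)).
Qed.

(** The difference between [p] and its Lagrange interpolant at [t] is divisible by the annihilating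
    product. The basis [l] depends on [t] alone, so the same one serves every [p] and [h]. *)
Lemma lagrange_annihilator (t : seq R) : uniq t ->
  annihilates s (\prod_(a <- t) ('X - (a%:C%C)%:P)) ->
  exists l : R -> {poly C}, forall (p : {poly C}) h, fibre_fun h ->
    E (fun x => p.[(s x)%:C%C] * h x) =
    \sum_(a <- t) p.[a%:C%C] * E (fun x => (l a).[(s x)%:C%C] * h x).
Proof.
move=> ut annt.
have /choice[l lP] (a : R) := separating_poly (a%:C%C) [seq b%:C%C | b <- t].
exists l => p h fh.
pose r := p - \sum_(a <- t) p.[a%:C%C] *: l a.
have rt : all (root r) [seq b%:C%C | b <- t].
  apply/allP => _ /mapP[b bt ->]; rewrite rootE /r hornerD hornerN subr_eq0.
  rewrite horner_sum (bigD1_seq b)//= hornerZ (lP b).1 mulr1.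
  rewrite big_seq_cond big1 ?addr0// => a /andP[at_ ab].
  rewrite hornerZ (lP a).2 ?mulr0 ?map_f//.
  by rewrite (inj_eq (@complexI R)) eq_sym.
have [|q rq] := uniq_roots_prod_XsubC rt.
  by rewrite uniq_rootsE map_inj_uniq//; exact: complexI.
have cl (a : R) : ccont (fun x => (l a).[(s x)%:C%C] * h x).
  by apply: ccontM; [have [] := fibre_fun_horner (l a)|exact: fh.1].
have r0 : E (fun x => r.[(s x)%:C%C] * h x) = 0.
  rewrite -(annt _ (fibre_funM (fibre_fun_horner q) fh)); congr E; apply/funext => x.
  by rewrite rq big_map hornerM mulrA; congr (_ * _); rewrite mulrC.
have -> : (fun x => p.[(s x)%:C%C] * h x) = (fun x =>
    \sum_(a <- t) p.[a%:C%C] * ((l a).[(s x)%:C%C] * h x) + r.[(s x)%:C%C] * h x).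
  apply/funext => x; rewrite /r hornerD hornerN horner_sum mulrBl mulr_suml.
  rewrite addrC -addrA [X in _ + X](_ : _ = 0) ?addr0//.
  by apply/eqP; rewrite addrC subr_eq0; apply/eqP/eq_bigr => a _; rewrite hornerZ mulrA.
rewrite (bfunD bE) ?(bfun_sum bE)// ?r0 ?addr0//.
  by apply: ccont_sum => a; apply: ccontM => //; exact: ccont_cst.
by apply: ccontM; [have [] := fibre_fun_horner r|exact: fh.1].
Qed.

(** Multiplying an annihilating polynomial by one that isolates an atom shows that it vanishes at
    each [t i], and its degree is at most [m]. *)
Lemma atoms_le (k : nat) (t : 'I_k -> R) (c : 'I_k -> C) : injective t ->
  (forall i, c i != 0) ->
  (forall p : {poly C}, E (fun x => p.[(s x)%:C%C]) = \sum_i c i * p.[(t i)%:C%C]) ->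
  (k <= m)%N.
Proof.
move=> tI c0 Ep; have [Q [Q0 sQ QE]] := annihilating_poly.
have := max_poly_roots Q0 (rs := [seq (t i)%:C%C | i <- enum 'I_k]).
rewrite size_map size_enum_ord => H; rewrite -ltnS; apply: leq_trans sQ; apply: H.
  apply/allP => _ /mapP[i _ ->]; rewrite rootE.
  have [p [p1 p0]] := separating_poly ((t i)%:C%C) [seq (t j)%:C%C | j <- enum 'I_k].
  have := Ep (Q * p); under eq_fun do rewrite hornerM.
  rewrite (QE _ (fibre_fun_horner p)) (bigD1 i)//= hornerM p1 mulr1 big1 ?addr0.
    by move/eqP; rewrite eq_sym mulf_eq0 (negbTE (c0 i)).
  move=> j ji; rewrite hornerM p0 ?mulr0//; first by apply: map_f; rewrite mem_enum.
  by apply: contra ji => /eqP/complexI/tI ->.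
by rewrite map_inj_uniq ?enum_uniq// => i j /complexI/tI.
Qed.

End OneFunction.

(** Interpolation in [s], then in [u], places weights on the product of two finite root sets; points
    of weight zero are discarded. The count [k] is bounded only later, by projecting the grid
    injectively to a line. *)
Lemma grid_representation (s u : T -> R) :
  continuous s -> (forall x y, zeta x = zeta y -> s x = s y) ->
  continuous u -> (forall x y, zeta x = zeta y -> u x = u y) ->
  exists (k : nat) (g : 'I_k -> R * R) (c : 'I_k -> C),
    [/\ injective g, forall i, c i != 0 & forall p q : {poly C},
      E (fun x => p.[(s x)%:C%C] * q.[(u x)%:C%C]) =
      \sum_i c i * (p.[(g i).1%:C%C] * q.[(g i).2%:C%C])].
Proof.
move=> cs fs cu fu.
have [t [ut annt]] := real_annihilator cs fs.
have [t' [ut' annt']] := real_annihilator cu fu.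
have [l lE] := lagrange_annihilator cs fs ut annt.
have [l' lE'] := lagrange_annihilator cu fu ut' annt'.
pose w (ab : R * R) := E (fun x => (l' ab.2).[(u x)%:C%C] * (l ab.1).[(s x)%:C%C]).
pose G := [seq ab <- [seq (a, b) | a <- t, b <- t'] | w ab != 0].
exists (size G), (tnth (in_tuple G)), (w \o tnth (in_tuple G)); split.
- apply/tuple_uniqP; rewrite filter_uniq//; apply: allpairs_uniq => //.
  by move=> [a b] [a' b'].
- by move=> i /=; have := mem_tnth i (in_tuple G); rewrite mem_filter => /andP[].
move=> p q; rewrite -(big_tnth _ _ G xpredT
  (fun ab => w ab * (p.[ab.1%:C%C] * q.[ab.2%:C%C]))) big_filter.
rewrite (lE p _ (fibre_fun_horner cu fu q)) [RHS]big_mkcond big_allpairs_dep /=.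
apply: eq_bigr => a _.
under eq_fun do rewrite mulrC.
rewrite (lE' q _ (fibre_fun_horner cs fs (l a))) mulr_sumr; apply: eq_bigr => b _.
have [w0|w0] := eqVneq (w (a, b)) 0; last by rewrite mulrA mulrC.
by rewrite -/(w (a, b)) w0 !mulr0.
Qed.
End Annihilators.

(** * Gluing the planar push-forwards *)

(** Each pair of distinct points excludes at most one [a]; the excluded values are the roots of the
    nonzero polynomial [P]. *)
Lemma generic_combination (F : numFieldType) k (g : 'I_k -> F * F) : injective g ->
  exists a : F, injective (fun i => (g i).1 + a * (g i).2).
Proof.
move=> gI.
pose f (ij : 'I_k * 'I_k) : {poly F} :=
  ((g ij.1).1 - (g ij.2).1)%:P + ((g ij.1).2 - (g ij.2).2) *: 'X.
pose P := \prod_(ij | ij.1 != ij.2) f ij.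
have P0 : P != 0.
  apply/prodf_neq0 => -[i j] /= ij; apply: contra ij => /eqP f0.
  have fij n : (f (i, j))`_n = 0 by rewrite f0 coef0.
  have := fij 0; have := fij 1; rewrite /f !coefD !coefC !coefZ !coefX /=.
  rewrite mulr0 mulr1 add0r addr0.
  move=> /eqP; rewrite subr_eq0 => /eqP e2 /eqP; rewrite subr_eq0 => /eqP e1.
  by apply/eqP/gI; rewrite (surjective_pairing (g i)) (surjective_pairing (g j)) e1 e2.
have [a Pa] : exists a, P.[a] != 0.
  apply: contrapT => nP; move/negP: P0; apply; apply/eqP/poly_horner_ext => a.
  by rewrite horner0; apply/eqP; apply: contrapT => /negP Pa; apply: nP; exists a.
exists a => i j ij; apply/eqP; apply: contrapT => /negP nij; move/negP: Pa; apply.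
rewrite horner_prod prodf_seq_eq0; apply/hasP; exists (i, j) => //=.
  by rewrite mem_index_enum.
rewrite nij /f hornerD hornerC hornerZ hornerX /= mulrBl addrACA -opprD.
by rewrite ![_ * a]mulrC ij subrr eqxx.
Qed.

Lemma continuous_linear_comb (R : realType) (T : topologicalType) (I : Type)
    (s : seq I) (c : I -> R) (f : I -> T -> R) : (forall i, continuous (f i)) ->
  continuous (fun x => \sum_(i <- s) c i * f i x).
Proof.
move=> cf; elim: s => [|i s IH].
  by under eq_fun do rewrite big_nil; exact: cst_continuous.
under eq_fun do rewrite big_cons.
move=> x; apply: cvgD; last exact: IH.
by apply: cvgM; [exact: cvg_cst|exact: cf].
Qed.

Section DiscreteMoments.
Context {R : realType} {d m : nat}.
Variables (K : set 'rV[R]_d) (E : ('rV[R]_d -> R[i]) -> R[i]).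
Hypotheses (cK : compact K) (bE : bounded_functional K E).
Local Notation C := R[i].
Local Notation V := 'rV[R]_d.
Implicit Types (xi eta x : V).

Definition linear_form xi x : R := \sum_j xi 0 j * x 0 j.

Lemma linear_form_continuous xi : continuous (linear_form xi).
Proof.
by apply: continuous_linear_comb => j; exact: coord_continuous.
Qed.

Lemma linear_formDZ xi eta a x :
  linear_form (xi + a *: eta) x = linear_form xi x + a * linear_form eta x.
Proof.
rewrite /linear_form mulr_sumr -big_split/=; apply: eq_bigr => j _.
by rewrite !mxE mulrDl mulrA.
Qed.

Hypothesis plane : forall xi eta, exists zeta : V -> C,
  [/\ ccont zeta,
      forall x y, zeta x = zeta y ->
        linear_form xi x = linear_form xi y /\ linear_form eta x = linear_form eta y
    & forall p q : 'I_m.+1 -> {poly C},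
        \det (\matrix_(i, j) E (fun x => (p i).[zeta x] * conjc (q j).[zeta x])) = 0].

Let Ep xi (p : {poly C}) := E (fun x => p.[(linear_form xi x)%:C%C]).

Let atoms xi k (t : 'I_k -> R) (c : 'I_k -> C) :=
  [/\ injective t, forall i, c i != 0 & forall p, Ep xi p = \sum_i c i * p.[(t i)%:C%C]].

Let grid xi eta k (g : 'I_k -> R * R) (c : 'I_k -> C) :=
  [/\ injective g, forall i, c i != 0 & forall p q : {poly C},
      E (fun x => p.[(linear_form xi x)%:C%C] * q.[(linear_form eta x)%:C%C]) =
      \sum_i c i * (p.[(g i).1%:C%C] * q.[(g i).2%:C%C])].

Let atoms_bound xi k t c : @atoms xi k t c -> (k <= m)%N.
Proof.
move=> [tI c0 pE]; have [z [cz fz dz]] := plane xi xi.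
have fx x y : z x = z y -> linear_form xi x = linear_form xi y by move=> /fz[].
exact: (atoms_le (const_mx 0) cK bE cz dz (@linear_form_continuous xi) fx tI c0 pE).
Qed.

Let grid_exists xi eta : exists k g c, @grid xi eta k g c.
Proof.
have [z [cz fz dz]] := plane xi eta.
have fx x y : z x = z y -> linear_form xi x = linear_form xi y by move=> /fz[].
have fe x y : z x = z y -> linear_form eta x = linear_form eta y by move=> /fz[].
exact: (grid_representation (const_mx 0) cK bE cz dz (@linear_form_continuous xi) fx
  (@linear_form_continuous eta) fe).
Qed.

Let grid_atoms xi eta k g c : @grid xi eta k g c ->
  exists a t, @atoms (xi + a *: eta) k t c.
Proof.
move=> [gI c0 gE]; have [a aI] := generic_combination gI.
exists a, (fun i => (g i).1 + a * (g i).2); split => // p.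
(* A grid evaluates only products [p(s) q(u)], hence the binomial expansion. The factor [1] gives
   the sum the shape that [bfun_sum] expects. *)
have expand (s u : R) : p.[(s + a * u)%:C%C] = \sum_(n < size p) 1 * (\sum_(j < n.+1)
    (p`_n * (a ^+ j)%:C%C *+ 'C(n, j)) * (('X^(n - j)).[s%:C%C] * ('X^j).[u%:C%C])).
  rewrite horner_coef; apply: eq_bigr => n _; rewrite mul1r.
  rewrite rmorphD rmorphM exprDn mulr_sumr; apply: eq_bigr => j _.
  rewrite !hornerXn exprMn rmorphXn /= mulrnAl mulrnAr; congr (_ *+ _).
  by rewrite -!mulrA; congr (_ * _); rewrite mulrCA.
have cX n j : ccont (fun x => ('X^n).[(linear_form xi x)%:C%C] *
    ('X^j).[(linear_form eta x)%:C%C] : C).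
  by apply: ccontM; apply: ccont_horner; apply: ccont_real; exact: linear_form_continuous.
rewrite /Ep; under eq_fun do rewrite linear_formDZ expand.
rewrite (bfun_sum bE); last first.
  move=> n; apply: ccont_sum => j; apply: ccontM => //; exact: ccont_cst.
under [RHS]eq_bigr do rewrite expand mulr_sumr.
rewrite exchange_big /=; apply: eq_bigr => n _.
rewrite mul1r (bfun_sum bE)//.
under [RHS]eq_bigr do rewrite mul1r mulr_sumr.
rewrite exchange_big /=; apply: eq_bigr => j _.
by rewrite gE mulr_sumr; apply: eq_bigr => i _; rewrite mulrCA.
Qed.

(* A direction [xi] whose push-forward has the maximal number of atoms: for every
   [eta] the atoms of the push-forward under [(xi, eta)] are then in bijection
   with those of [xi], and their second coordinates depend linearly on [eta]. *)
Lemma discrete_moments : exists k (P : 'I_k -> V) (c : 'I_k -> C), (k <= m)%N /\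
  forall eta (p : {poly C}), E (fun x => p.[(linear_form eta x)%:C%C]) =
    \sum_i c i * p.[(linear_form eta (P i))%:C%C].
Proof.
pose has_atoms k := `[< exists xi t c, @atoms xi k t c >].
have hex : exists k, has_atoms k.
  have [k [g [c gr]]] := grid_exists 0 0.
  have [a [t at_]] := grid_atoms gr.
  by exists k; apply/asboolP; exists (0 + a *: 0), t, c.
have hle k : has_atoms k -> (k <= m)%N.
  by move=> /asboolP[xi [t [c /atoms_bound]]].
have [r /asboolP[xi [t [c [tI c0 tE]]]] rmax] := ex_maxnP hex hle.
have rm : (r <= m)%N by apply: hle; apply/asboolP; exists xi, t, c.
have key eta : exists w : 'I_r -> R, forall p q : {poly C},
    E (fun x => p.[(linear_form xi x)%:C%C] * q.[(linear_form eta x)%:C%C]) =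
    \sum_i c i * (p.[(t i)%:C%C] * q.[(w i)%:C%C]).
  have [k [g [b gr]]] := grid_exists xi eta.
  have [a [t' at']] := grid_atoms gr.
  have kr : (k <= r)%N by apply: rmax; apply/asboolP; exists (xi + a *: eta), t', b.
  have [gI b0 gE] := gr.
  (* With [q = 1] both families represent the same push-forward under [xi]. *)
  have gE1 p : \sum_i b i * p.[(g i).1%:C%C] = \sum_i c i * p.[(t i)%:C%C].
    rewrite -tE /Ep; have := gE p 1.
    under eq_fun do rewrite hornerC mulr1.
    by move=> ->; apply: eq_bigr => i _; rewrite hornerC mulr1.
  pose L := [seq (g j).1%:C%C | j <- enum 'I_k] ++ [seq (t j)%:C%C | j <- enum 'I_r] : seq C.
  have tL i p : (forall z, z \in L -> z != (t i)%:C%C -> p.[z] = 0) ->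
      \sum_j c j * p.[(t j)%:C%C] = c i * p.[(t i)%:C%C].
    move=> pL; rewrite (bigD1 i)//= big1 ?addr0// => j ji; rewrite pL ?mulr0//.
      by rewrite mem_cat (map_f (fun j => (t j)%:C%C)) ?mem_enum ?orbT.
    by apply: contra ji => /eqP/complexI/tI ->.
  (* If no grid point lay above [t i], a polynomial isolating [t i] would force [c i = 0]. *)
  have /choice[sg sgE] (i : 'I_r) : exists j, (g j).1 = t i.
    apply: contrapT => nj.
    have [p [p1 pL]] := separating_poly ((t i)%:C%C) L.
    have := gE1 p; rewrite (tL i)// p1 mulr1 big1 => [/esym/eqP|j _].
      by rewrite (negbTE (c0 i)).
    rewrite pL ?mulr0//; first by rewrite mem_cat (map_f (fun j => (g j).1%:C%C)) ?mem_enum.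
    by apply/eqP => /complexI gj; apply: nj; exists j.
  have sgI : injective sg by move=> i j ij; apply: tI; rewrite -!sgE ij.
  (* [sg] injects [r] atoms into [k] grid points, and [k <= r] by maximality; so exactly one grid
     point lies above each atom. *)
  have [sg' sgK sg'K] : bijective sg by apply: inj_card_bij => //; rewrite !card_ord.
  have g1I j j' : (g j).1 = (g j').1 -> j = j'.
    by rewrite -(sg'K j) -(sg'K j') !sgE => /tI ->.
  have bc i : b (sg i) = c i.
    have [p [p1 pL]] := separating_poly ((t i)%:C%C) L.
    have := gE1 p; rewrite (tL i)// p1 mulr1 (bigD1 (sg i))//= sgE p1 mulr1.
    rewrite big1 ?addr0// => j ji; rewrite pL ?mulr0//.
      by rewrite mem_cat (map_f (fun j => (g j).1%:C%C)) ?mem_enum.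
    by apply: contra ji => /eqP/complexI; rewrite -sgE => /g1I ->.
  exists (fun i => (g (sg i)).2) => p q; rewrite gE (reindex sg)/=; last first.
    by apply: onW_bij; exists sg'.
  by apply: eq_bigr => i _; rewrite bc sgE.
have /choice[w wE] := key.
pose L := [seq (t j)%:C%C | j <- enum 'I_r] : seq C.
(* With [p] isolating [t i], the integral of [p(xi) * eta] is [c i * w eta i]. The integral is
   linear in [eta], hence so is [w]. *)
have wl i eta : w eta i = \sum_j eta 0 j * w (delta_mx 0 j) i.
  have [p [p1 pL]] := separating_poly ((t i)%:C%C) L.
  have wi xi' : E (fun x => p.[(linear_form xi x)%:C%C] * (linear_form xi' x)%:C%C) =
      c i * (w xi' i)%:C%C.
    have := wE xi' p 'X; under eq_fun do rewrite hornerX.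
    move=> ->; rewrite (bigD1 i)//= p1 hornerX mul1r big1 ?addr0// => j ji.
    rewrite pL ?mul0r ?mulr0//; first by rewrite (map_f (fun j => (t j)%:C%C)) ?mem_enum.
    by apply: contra ji => /eqP/complexI/tI ->.
  apply: complexI; apply: (mulfI (c0 i)); rewrite -wi rmorph_sum mulr_sumr.
  under [RHS]eq_bigr do rewrite rmorphM mulrCA -wi.
  rewrite -(bfun_sum bE); last first.
    move=> j; apply: ccontM; last exact/ccont_real/linear_form_continuous.
    by apply: ccont_horner; exact/ccont_real/linear_form_continuous.
  congr E; apply/funext => x; under [RHS]eq_bigr do rewrite mulrCA.
  rewrite -mulr_sumr; congr (_ * _); rewrite rmorph_sum; apply: eq_bigr => j _.
  rewrite rmorphM; congr (_ * _); congr (_%:C)%C.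
  rewrite /linear_form (bigD1 j)//= mxE !eqxx mul1r big1 ?addr0// => j' jj'.
  by rewrite mxE eqxx (negbTE jj') mul0r.
exists r, (fun i => \row_j w (delta_mx 0 j) i), c; split => // eta p.
have := wE eta 1 p; under eq_fun do rewrite hornerC mul1r.
move=> ->; apply: eq_bigr => i _; rewrite hornerC mul1r wl.
by congr (_ * p.[_%:C%C]); apply: eq_bigr => j _; rewrite mxE.
Qed.

End DiscreteMoments.

(** * Integration against the measure *)

Section PolynomialIntegrals.
Context {R : realType} {d : nat}.
Local Notation C := R[i].
Local Notation V := 'rV[R]_d.

Lemma open_measurable_borelRd (U : set V) :
  open U -> measurable (U : set (borelRd R d)).
Proof. exact: sub_sigma_algebra. Qed.

Lemma closed_measurable_borelRd (U : set V) :
  closed U -> measurable (U : set (borelRd R d)).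
Proof.
move=> cU; rewrite -(setCK U); apply: measurableC.
by apply: open_measurable_borelRd; exact: closed_openC.
Qed.

Lemma continuous_measurable_borelRd (f : V -> R) (D : set (borelRd R d)) :
  measurable D -> continuous f -> measurable_fun D (f : borelRd R d -> R).
Proof.
move=> mD cf; apply: (measurable_funS measurableT) => //.
apply: (measurability _ (measurable_realfun.RGenOInfty.measurableE R)) => _ [_ [a ->] <-].
rewrite setTI; apply: open_measurable_borelRd.
by apply: open_comp => //; exact: interval_open.
Qed.

Section PositiveMeasure.
Variables (m : {finite_measure set (borelRd R d) -> \bar R}) (K : set V).
Hypotheses (cK : compact K) (mK : m (~` K) = 0%E).

Let mKm : measurable (K : set (borelRd R d)).
Proof.
by apply: closed_measurable_borelRd; apply: compact_closed => //; exact: norm_hausdorff.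
Qed.

Lemma continuous_integrable_borelRd (f : V -> R) : continuous f ->
  m.-integrable setT (EFin \o (f : borelRd R d -> R)).
Proof.
move=> cf.
have mf : measurable_fun (setT : set (borelRd R d)) (fun x => (f x)%:E).
  by apply/measurable_EFinP; exact: continuous_measurable_borelRd.
apply/(negligible_integrable (measurableC mKm) measurableT mf mK).
rewrite setTD setCK; apply: measurable_bounded_integrable => //.
- by rewrite ltey_eq fin_num_measure.
- exact: continuous_measurable_borelRd.
have : compact (f @` K) by apply: continuous_compact => //; exact: continuous_subspaceT.
move=> /compact_bounded[M [Mr fM]]; exists M; split => // x Mx y Ky.
by apply: fM => //; exists y.
Qed.

Lemma Rintegral_linear (a : R) (f g : V -> R) : continuous f -> continuous g ->
  Rintegral m setT (fun x => a * f x + g x) =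
  a * Rintegral m setT f + Rintegral m setT g.
Proof.
move=> cf cg; rewrite RintegralD//.
- by rewrite RintegralZl//; exact: continuous_integrable_borelRd.
- apply: continuous_integrable_borelRd => x.
  by apply: continuousM; [exact: cst_continuous|exact: cf].
- exact: continuous_integrable_borelRd.
Qed.

Lemma Rintegral_bounded (f : V -> R) (B : R) : continuous f -> 0 <= B ->
  (forall x, K x -> `|f x| <= B) ->
  `|Rintegral m setT f| <= B * fine (m setT).
Proof.
move=> cf B0 fB; have intf := continuous_integrable_borelRd cf.
have intK : m.-integrable K (EFin \o (f : borelRd R d -> R)).
  exact: integrableS intf.
have -> : Rintegral m setT f = Rintegral m K f.
  rewrite /Rintegral (negligible_integral _ _ _ mK)//; first by rewrite setTD setCK.
  exact: measurableC.
apply: le_trans (le_normr_Rintegral mKm intK) _.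
apply: (@le_trans _ _ (Rintegral m K (cst B))).
  apply: le_Rintegral => //.
  - exact: (integrable_norm intK).
  - apply: measurable_bounded_integrable => //; first by rewrite ltey_eq fin_num_measure.
    by exists B; split; [exact: num_real|move=> y By x _; rewrite /= ger0_norm// ltW].
rewrite Rintegral_cst// ler_wpM2l// fine_le ?fin_num_measure//.
by apply: le_measure => //; exact/mem_set.
Qed.

Lemma cint_pos_linear (c : C) (F G : V -> C) : ccont F -> ccont G ->
  cint_pos m (fun x => c * F x + G x) = c * cint_pos m F + cint_pos m G.
Proof.
move=> [rF iF] [rG iG]; case: c => a b; rewrite /cint_pos.
have cadd (e : R) (f g : V -> R) : continuous f -> continuous g ->
    continuous (fun x => e * f x + g x).
  move=> cf cg.
  have := @continuous_linear_comb R V bool [:: true; false]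
    (fun i => if i then e else 1) (fun i => if i then f else g).
  under eq_fun do rewrite !big_cons big_nil addr0 mul1r.
  by apply; case.
apply/eqP; rewrite eq_complex /=; apply/andP; split; apply/eqP.
  have -> : (fun x => complex.Re (Complex a b * F x + G x)) =
      (fun x => a * complex.Re (F x) + ((- b) * complex.Im (F x) + complex.Re (G x))).
    by apply/funext => x; rewrite ReD ReM /= mulNr addrA.
  rewrite !Rintegral_linear//; last exact: cadd.
  by rewrite mulNr addrA.
have -> : (fun x => complex.Im (Complex a b * F x + G x)) =
    (fun x => a * complex.Im (F x) + (b * complex.Re (F x) + complex.Im (G x))).
  by apply/funext => x; rewrite ImD ImM /= addrA.
rewrite !Rintegral_linear//; last exact: cadd.
by rewrite addrA.
Qed.

Lemma cint_pos_bounded (F : V -> C) (B : R) : ccont F -> 0 <= B ->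
  (forall x, K x -> cn (F x) <= B) -> cn (cint_pos m F) <= 2 * fine (m setT) * B.
Proof.
move=> [rF iF] B0 FB; apply: le_trans (cn_le _) _ => /=.
have h1 := Rintegral_bounded rF B0 (fun x Kx => le_trans (Re_le_cn (F x)) (FB x Kx)).
have h2 := Rintegral_bounded iF B0 (fun x Kx => le_trans (Im_le_cn (F x)) (FB x Kx)).
by apply: le_trans (lerD h1 h2) _; rewrite -mulrA (mulrC (fine _)); lra.
Qed.

End PositiveMeasure.

Variables (mu : cmeasure R d) (K : set V).
Hypothesis cK : compact K.
Hypothesis muK : [/\ cm_rp mu (~` K) = 0%E, cm_rn mu (~` K) = 0%E,
  cm_ip mu (~` K) = 0%E & cm_in mu (~` K) = 0%E].

Lemma cintegral_bounded_functional : bounded_functional K (cintegral mu).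
Proof.
have [k1 k2 k3 k4] := muK; split.
  move=> c F G cF cG; rewrite /cintegral.
  rewrite (cint_pos_linear cK k1)// (cint_pos_linear cK k2)//.
  rewrite (cint_pos_linear cK k3)// (cint_pos_linear cK k4)//.
  set i := 'i%C.
  have h (u v w z : C) : c * u + v - (c * w + z) = c * (u - w) + (v - z).
    by rewrite opprD addrACA mulrBr.
  by rewrite !h (mulrDr i) (mulrCA i) addrACA -mulrDr.
exists (2 * fine (cm_rp mu setT) + 2 * fine (cm_rn mu setT) +
  (2 * fine (cm_ip mu setT) + 2 * fine (cm_in mu setT))).
  by rewrite !addr_ge0// mulr_ge0// fine_ge0.
move=> F B cF B0 FB; rewrite /cintegral.
have i1 : cn ('i%C : C) = 1 by rewrite /cn /= expr0n expr1n add0r sqrtr1.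
apply: le_trans (cnD _ _) _; rewrite cnM i1 mul1r mulrDl.
rewrite [X in _ <= X + _]mulrDl [X in _ <= _ + X]mulrDl.
apply: lerD; apply: le_trans (cnB _ _) _; apply: lerD.
- exact: (cint_pos_bounded cK k1).
- exact: (cint_pos_bounded cK k2).
- exact: (cint_pos_bounded cK k3).
- exact: (cint_pos_bounded cK k4).
Qed.

End PolynomialIntegrals.

(** * Harmonic polynomials of isotropic linear forms *)

Section IsotropicPlanes.
Context {R : realType} {d : nat}.
Local Notation C := R[i].
Local Notation V := 'rV[R]_d.
Implicit Types (b c xi eta x : V).

Lemma linear_formC xi x : linear_form xi x = linear_form x xi.
Proof. by apply: eq_bigr => j _; rewrite mulrC. Qed.

Lemma linear_form_delta xi j : linear_form xi (delta_mx 0 j) = xi 0 j.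
Proof.
rewrite /linear_form (bigD1 j)//= mxE !eqxx mulr1 big1 ?addr0// => i ij.
by rewrite mxE eqxx (negbTE ij) mulr0.
Qed.

Lemma linear_formZ a xi x : linear_form (a *: xi) x = a * linear_form xi x.
Proof. by rewrite /linear_form mulr_sumr; apply: eq_bigr => j _; rewrite mxE mulrA. Qed.

Lemma linear_form_gt0 xi : xi != 0 -> 0 < linear_form xi xi.
Proof.
move=> xi0; have ge0 : 0 <= linear_form xi xi.
  by apply: sumr_ge0 => j _; rewrite -expr2 sqr_ge0.
rewrite lt_neqAle ge0 andbT eq_sym; apply: contra xi0 => /eqP h.
apply/eqP/rowP => j; rewrite mxE; apply/eqP; rewrite -sqrf_eq0 expr2.
have nn i : true -> 0 <= xi 0 i * xi 0 i by rewrite -expr2 sqr_ge0.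
by apply/eqP; exact: (psumr_eq0P nn h isT).
Qed.

Lemma orthogonal_vector b : (1 < d)%N -> b != 0 ->
  exists2 c, c != 0 & linear_form b c = 0.
Proof.
move=> d1 b0.
have [k bk] : exists k, b 0 k != 0.
  apply: contrapT => nk; move/negP: b0; apply; apply/eqP/rowP => k; rewrite mxE.
  by apply/eqP; apply: contrapT => /negP bk; apply: nk; exists k.
have [l lk] : exists l, l != k.
  have [k0|k0] := eqVneq (k : nat) 0%N.
    by exists (Ordinal d1); rewrite -val_eqE /= k0.
  by exists (Ordinal (ltnW d1)); rewrite -val_eqE /= eq_sym.
(* A quarter turn in the coordinate plane of [k] and [l]; it is nonzero because [b 0 k] is. *)
pose c : V := b 0 l *: delta_mx 0 k - b 0 k *: delta_mx 0 l.
exists c.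
  apply/eqP => /rowP/(_ l); rewrite !mxE !eqxx (negbTE lk) /= mulr0 add0r mulr1.
  by move/eqP; rewrite oppr_eq0 (negbTE bk).
rewrite linear_formC /c -[X in linear_form X _](addr0 _) -scaleNr addr0.
rewrite linear_formDZ linear_formZ ![linear_form (delta_mx _ _) _]linear_formC.
rewrite !linear_form_delta.
by rewrite mulNr mulrC subrr.
Qed.

(** Gram-Schmidt with equalized lengths, so that [b + i c] is isotropic. When [xi] and [eta] are
    dependent or zero, auxiliary vectors complete the pair. *)
Lemma orthogonal_basis xi eta : (1 < d)%N -> exists b c,
  [/\ linear_form b c = 0, linear_form c c = linear_form b b,
      exists s t : R, xi = s *: b + t *: c & exists s t : R, eta = s *: b + t *: c].
Proof.
move=> d1.
have [b b0 [x0 xib]] : exists2 b, b != 0 & exists s : R, xi = s *: b.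
  have [->|xi0] := eqVneq xi 0; last by exists xi => //; exists 1; rewrite scale1r.
  exists (const_mx 1); last by exists 0; rewrite scale0r.
  apply/eqP => /rowP/(_ (Ordinal d1)); rewrite !mxE => /eqP.
  by rewrite oner_eq0.
have bb := linear_form_gt0 b0.
pose u := eta + (- (linear_form eta b / linear_form b b)) *: b.
have bu : linear_form b u = 0.
  by rewrite linear_formC linear_formDZ mulNr divfK ?subrr// gt_eqF.
have [w w0 [bw [y uw]]] : exists2 w, w != 0 & linear_form b w = 0 /\ exists s : R, u = s *: w.
  have [u0|u0] := eqVneq u 0; last by exists u => //; split => //; exists 1; rewrite scale1r.
  have [w w0 bw] := orthogonal_vector d1 b0.
  by exists w => //; split => //; exists 0; rewrite scale0r.
have ww := linear_form_gt0 w0.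
pose k := Num.sqrt (linear_form b b / linear_form w w).
have k0 : k != 0 by rewrite gt_eqF// sqrtr_gt0 divr_gt0.
exists b, (k *: w); split.
- by rewrite linear_formC linear_formZ linear_formC bw mulr0.
- rewrite linear_formZ linear_formC linear_formZ mulrA -expr2 sqr_sqrtr.
    by rewrite divfK// gt_eqF.
  by rewrite divr_ge0// ltW.
- by exists x0, 0; rewrite scale0r addr0.
exists (linear_form eta b / linear_form b b), (y / k).
by rewrite scalerA divfK// -uw /u scaleNr addrC subrK.
Qed.

Section Isotropic.
Variable a : 'I_d -> C.

Definition linear_mpoly : cpoly R d := \sum_j a j *: mpolyX C U_(j).

Definition linear_comp (h : {poly C}) : cpoly R d :=
  (map_poly (@mpolyC d C) h).[linear_mpoly].

Lemma mderiv_linear_mpoly i : mderiv i linear_mpoly = mpolyC d (a i).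
Proof.
rewrite /linear_mpoly raddf_sum /= (bigD1 i)//= mderivZ mderivX mnm1E eqxx scale1r.
rewrite big1 ?addr0 => [|j ji].
  rewrite (_ : (U_(i) - U_(i))%MM = 0%MM) ?mpolyX0 ?alg_mpolyC//.
  by apply/mnmP => k; rewrite mnmBE subnn mnm0E.
by rewrite mderivZ mderivX mnm1E (negbTE ji) scale0r scaler0.
Qed.

Lemma mderiv_linear_comp i h :
  mderiv i (linear_comp h) = mpolyC d (a i) * linear_comp (deriv h).
Proof.
elim/poly_ind: h => [|h c IH].
  by rewrite /linear_comp derivC !rmorph0 !horner0 mulr0 raddf0.
rewrite /linear_comp derivMXaddC !rmorphD !rmorphM /= !map_polyX !map_polyC /=.
rewrite !hornerE mderivD mderivM mderivC addr0 mderiv_linear_mpoly.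
rewrite [mderiv i _]IH /linear_comp mulrDr addrC mulrC; congr (_ + _).
by rewrite mulrA.
Qed.

(** By the chain rule, the Laplacian of [h (a . x)] is the sum of the [a j ^+ 2] times
    [h'' (a . x)]. *)
Lemma harmonic_linear_comp h : \sum_j a j ^+ 2 = 0 -> Defs.harmonic (linear_comp h).
Proof.
move=> a0; rewrite /Defs.harmonic /laplacian.
under eq_bigr do rewrite mderiv_linear_comp mderivM mderivC mul0r add0r
  mderiv_linear_comp mulrA -rmorphM /= -expr2.
by rewrite -mulr_suml -rmorph_sum /= a0 rmorph0 mul0r.
Qed.

Lemma peval_linear_comp h x :
  peval (linear_comp h) x = h.[(\sum_j a j * (x 0 j)%:C%C)].
Proof.
elim/poly_ind: h => [|h c IH].
  by rewrite /linear_comp rmorph0 !horner0 /peval raddf0.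
rewrite /linear_comp rmorphD rmorphM /= map_polyX map_polyC /= !hornerE.
rewrite /peval mevalD mevalM mevalC; congr (_ * _ + _); first exact: IH.
rewrite /linear_mpoly raddf_sum /=; apply: eq_bigr => j _.
by rewrite mevalZ mevalXU.
Qed.

End Isotropic.
End IsotropicPlanes.

(** * Determinants of harmonic polynomials from the finite rank *)

Lemma det_mul_rank_lt (F : fieldType) N M L
    (U : 'M[F]_(N, M)) (H : 'M[F]_(M, L)) (W : 'M[F]_(L, N)) :
  (\rank H < N)%N -> \det (U *m H *m W) = 0.
Proof.
move=> rH; apply/eqP; apply: contrapT => /negP d0.
have : U *m H *m W \in unitmx by rewrite unitmxE unitfE.
move/mxrank_unit => r; move: rH; rewrite -[X in (_ < X)%N]r ltnNge => /negP; apply.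
exact: leq_trans (mxrankM_maxl _ _) (mxrankM_maxr _ _).
Qed.

Section HarmonicRank.
Context {R : realType} {d m : nat}.
Local Notation C := R[i].
Local Notation V := 'rV[R]_d.
Variables (K : set V) (mu : cmeasure R d) (I : Type) (f : I -> cpoly R d).
Hypothesis bE : bounded_functional K (cintegral mu).
Hypotheses (hf : harmonic_spanning f) (hrank : infmx_rank_eq (Hmx mu f) m).

Lemma ccont_peval (p : cpoly R d) : ccont (peval p).
Proof.
elim/mpolyind: p => [|c mo p _ _ IH].
  rewrite (_ : peval 0 = (fun=> 0)); first exact: ccont_cst.
  by apply/funext => x; rewrite /peval raddf0.
rewrite (_ : peval _ = (fun x : V => c * (\prod_i ('X^(mo i)).[(x ord0 i)%:C%C]) + peval p x)).
  apply: ccontD => //; apply: ccontM; first exact: ccont_cst.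
  apply: ccont_prod => i; apply: ccont_horner; apply: ccont_real.
  exact: coord_continuous.
apply/funext => x; rewrite /peval mevalD mevalZ mevalX; congr (_ * _ + _).
by apply: eq_bigr => i _; rewrite hornerXn.
Qed.

(** Expanding [P] and [Q] in the spanning system factors the matrix through a finite submatrix of
    [Hmx mu f], of rank at most [m]. The statement obtained no longer mentions the system [f]. *)
Lemma harmonic_det0 (P Q : 'I_m.+1 -> cpoly R d) :
  (forall i, Defs.harmonic (P i)) -> (forall i, Defs.harmonic (Q i)) ->
  \det (\matrix_(i, j) cintegral mu (fun x => peval (P i) x * conjc (peval (Q j) x))) = 0.
Proof.
move=> hP hQ.
have span (G : 'I_m.+1 -> cpoly R d) : (forall i, Defs.harmonic (G i)) ->
    exists (S : finType) (al : S -> I) (u : 'I_m.+1 -> S -> C),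
      forall i, G i = \sum_t u i t *: f (al t).
  move=> hG.
  have /choice[k kP] i : exists k : nat, exists (a : 'I_k -> I) (c : 'I_k -> C),
      G i = \sum_(j < k) c j *: f (a j).
    exact: (hf.2 _ (hG i)).
  have zS i : {ac : ('I_(k i) -> I) * ('I_(k i) -> C) |
      G i = \sum_(j < k i) ac.2 j *: f (ac.1 j)}.
    by apply: cid; have [a [c Gi]] := kP i; exists (a, c).
  pose z i := sval (zS i); have zP i := svalP (zS i).
  (* The disjoint union of the index sets serves all [G i] at once; the coefficients of [G i] are
     zero outside its own block. *)
  pose S := {i : 'I_m.+1 & 'I_(k i)}.
  exists S, (fun t => (z (tag t)).1 (tagged t)),
    (fun i t => if tag t == i then (z (tag t)).2 (tagged t) else 0) => i.
  transitivity (\sum_i' \sum_(j < k i')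
      (if i' == i then (z i').2 j else 0) *: f ((z i').1 j)).
    rewrite (bigD1 i)//= [X in _ + X]big1 ?addr0.
      by rewrite zP; apply: eq_bigr => j _; rewrite eqxx.
    by move=> i' ii'; rewrite big1// => j _; rewrite (negbTE ii') scale0r.
  by rewrite (sig_big_dep _ (fun i' j => true) (fun i' (j : 'I_(k i')) =>
    (if i' == i then (z i').2 j else 0) *: f ((z i').1 j)))/=; apply: eq_bigl.
have [S [al [u uP]]] := span P hP.
have [S' [be [v vQ]]] := span Q hQ.
have pe (G : cpoly R d) (J : finType) (w : J -> C) (ga : J -> I) x :
    G = \sum_t w t *: f (ga t) -> peval G x = \sum_t w t * peval (f (ga t)) x.
  by move=> ->; rewrite /peval raddf_sum; apply: eq_bigr => t _; exact: mevalZ.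
have cP a b : ccont (fun x => peval (f a) x * conjc (peval (f b) x)).
  by apply: ccontM; [|apply: ccont_conj]; exact: ccont_peval.
have E i j : cintegral mu (fun x => peval (P i) x * conjc (peval (Q j) x)) =
    \sum_t \sum_t' u i t * (Hmx mu f (al t) (be t') * conjc (v j t')).
  have -> : (fun x => peval (P i) x * conjc (peval (Q j) x)) = (fun x =>
      \sum_t u i t * (\sum_t' conjc (v j t') *
        (peval (f (al t)) x * conjc (peval (f (be t')) x)))).
    apply/funext => x; rewrite (pe _ _ _ _ x (uP i)) (pe _ _ _ _ x (vQ j)).
    rewrite mulr_suml; apply: eq_bigr => t _; rewrite -mulrA; congr (_ * _).
    rewrite rmorph_sum mulr_sumr; apply: eq_bigr => t' _.
    by rewrite rmorphM mulrCA.
  rewrite (bfun_sum bE) => [|t]; last first.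
    by apply: ccont_sum => t'; apply: ccontM => //; exact: ccont_cst.
  apply: eq_bigr => t _; rewrite (bfun_sum bE) // mulr_sumr; apply: eq_bigr => t' _.
  by rewrite mulrC [conjc _ * _]mulrC mulrC.
pose A := \matrix_(i < m.+1, r < #|S|) u i (enum_val r).
pose B := \matrix_(r < #|S'|, j < m.+1) conjc (v j (enum_val r)).
pose H := \matrix_(r < #|S|, r' < #|S'|) Hmx mu f (al (enum_val r)) (be (enum_val r')).
have -> : \matrix_(i, j) cintegral mu (fun x => peval (P i) x * conjc (peval (Q j) x)) =
    A *m H *m B.
  apply/matrixP => i j; rewrite -mulmxA [LHS]mxE E [RHS]mxE.
  rewrite (reindex (@enum_val S S))/=; last first.
    by apply: onW_bij; exact: enum_val_bij.
  apply: eq_bigr => r _; rewrite !mxE mulr_sumr (reindex (@enum_val S' S'))/=; last first.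
    by apply: onW_bij; exact: enum_val_bij.
  by apply: eq_bigr => r' _; rewrite !mxE.
apply: det_mul_rank_lt; rewrite ltnS.
exact: (hrank.1 _ _ (al \o enum_val) (be \o enum_val)).
Qed.

(** [zeta] is the linear form of the isotropic vector [b + i c]. Its real and imaginary parts are
    the forms of [b] and [c], which determine those of [xi] and [eta]. *)
Lemma isotropic_plane : compact K -> (1 < d)%N -> forall xi eta, exists zeta : V -> C,
  [/\ ccont zeta,
      forall x y, zeta x = zeta y ->
        linear_form xi x = linear_form xi y /\ linear_form eta x = linear_form eta y
    & forall p q : 'I_m.+1 -> {poly C},
        \det (\matrix_(i, j)
          cintegral mu (fun x => (p i).[zeta x] * conjc (q j).[zeta x])) = 0].
Proof.
move=> cK d1 xi eta.
have [b [c [bc cc [s1 [t1 xiE]] [s2 [t2 etaE]]]]] := orthogonal_basis xi eta d1.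
pose a j : C := Complex (b 0 j) (c 0 j).
pose zeta (x : V) : C := \sum_j a j * (x 0 j)%:C%C.
have zE x : zeta x = Complex (linear_form b x) (linear_form c x).
  rewrite /zeta /linear_form; elim/big_ind3: _ => // [z u v z' u' v' -> ->//|j _].
  by rewrite /a; apply/eqP; rewrite eq_complex /= !mulr0 subr0 add0r !eqxx.
have a0 : \sum_j a j ^+ 2 = 0.
  have : \sum_j a j ^+ 2 = Complex (linear_form b b - linear_form c c) (2 * linear_form b c).
    rewrite /linear_form mulr_sumr -sumrB.
    elim/big_ind3: _ => // [z u v z' u' v' -> ->//|j _].
    by rewrite /a expr2; apply/eqP; rewrite eq_complex /=; apply/andP; split; apply/eqP; ring.
  by rewrite bc cc subrr mulr0.
exists zeta; split.
- rewrite (_ : zeta = (fun x => (linear_form b x)%:C%C + 'i%C * (linear_form c x)%:C%C)).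
    apply: ccontD; first exact/ccont_real/linear_form_continuous.
    by apply: ccontM; [exact: ccont_cst|exact/ccont_real/linear_form_continuous].
  by apply/funext => x; rewrite zE [LHS]complexE.
- move=> x y; rewrite !zE => -[bxy cxy].
  have lE s t z : linear_form (s *: b + t *: c) z = s * linear_form b z + t * linear_form c z.
    by rewrite linear_formDZ linear_formZ.
  by rewrite xiE etaE !lE bxy cxy.
move=> p q.
have := harmonic_det0 (P := fun i => linear_comp a (p i)) (Q := fun i => linear_comp a (q i)).
move=> H; rewrite -[RHS]H => [|i|i]; try exact: harmonic_linear_comp.
congr (\det _); apply/matrixP => i j; rewrite !mxE; congr cintegral; apply/funext => x.
by rewrite !peval_linear_comp.
Qed.

End HarmonicRank.

(** * From moments to the support *)

(** The distance to the complement works; the constant 1 replaces it when the complement is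
    empty. *)
Lemma open_positivity_set (R : realType) (V : normedModType R) (W : set V) :
  open W -> exists g : V -> R, [/\ continuous g, forall x, 0 <= g x
    & forall x, W x <-> 0 < g x].
Proof.
move=> oW; have [WT|/set0P[a Wa]] := eqVneq (~` W) set0.
  exists (fun=> 1); split => // [|x]; first exact: cst_continuous.
  by rewrite ltr01; split => // _; apply: contrapT => nWx; have : (~` W) x by []; rewrite WT.
pose D x := [set `|x - y| | y in ~` W].
have D0 x : D x !=set0 by exists `|x - a|; exists a.
have lbD x : has_lbound (D x) by exists 0 => _ [y _ <-].
have gD x y : (~` W) y -> inf (D x) <= `|x - y|.
  by move=> Wy; apply: ge_inf => //; exists y.
have lip x z : inf (D x) <= `|x - z| + inf (D z).
  rewrite -lerBlDl; apply: lb_le_inf => // _ [y Wy <-].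
  by rewrite lerBlDl (le_trans (gD x y Wy))// -[x - y](subrKA z) ler_normD.
exists (fun x => inf (D x)); split.
- move=> x; apply/cvgrPdist_lt => e e0; near=> z.
  have : ball x e z by near: z; exact: nbhsx_ballx.
  rewrite -ball_normE /= => xz.
  have := lip x z; have := lip z x; rewrite (distrC z x) => h1 h2.
  by rewrite ltr_norml; lra.
- by move=> x; apply: lb_le_inf => // _ [y _ <-].
move=> x; split => [Wx|gx]; last first.
  apply: contrapT => nWx; have := gD x x nWx; rewrite subrr normr0; lra.
have /nbhs_ballP[e /= e0 eW] : nbhs x W by exact: open_nbhs_nbhs.
apply: lt_le_trans e0 _; apply: lb_le_inf => // _ [y Wy <-].
rewrite leNgt; apply/negP => xy; apply: Wy; apply: eW.
by rewrite -ball_normE.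
Unshelve. all: by end_near. Qed.

Section MeasureUniqueness.
Context {R : realType} {d : nat}.
Local Notation V := 'rV[R]_d.
Variables (m1 m2 : {finite_measure set (borelRd R d) -> \bar R}) (K S : set V).
Hypotheses (cK : compact K) (K1 : m1 (~` K) = 0%E) (K2 : m2 (~` K) = 0%E).
Hypothesis m12 : forall f : V -> R, continuous f -> (forall x, S x -> f x = 0) ->
  Rintegral m1 setT f = Rintegral m2 setT f.

Let measure_open (W : set V) : open W -> W `&` S = set0 -> m1 W = m2 W.
Proof.
move=> oW WS; have [g [cg g0 gW]] := open_positivity_set oW.
(* These functions tend to the indicator of [W], are bounded by 1 and vanish off [W], hence on [S];
   dominated convergence then applies to both measures. *)
pose f (n : nat) (x : V) := Num.min 1 (n%:R * g x).
have cf n : continuous (f n).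
  move=> x; apply: (@continuous_min _ _ (fun=> 1) (fun x => n%:R * g x)).
    exact: cst_continuous.
  by apply: continuousM; [exact: cst_continuous|exact: cg].
have f01 n x : 0 <= f n x <= 1.
  by rewrite /f le_min ler01 ge_min lexx /= andbT mulr_ge0.
have flim x : (f n x)%:E @[n --> \oo] --> (\1_W x)%:E.
  apply: cvg_near_cst; have [Wx|nWx] := pselect (W x).
    have gx := (gW x).1 Wx; rewrite indicE mem_set//.
    exists (Num.truncn (g x)^-1).+1 => // n /= Nn; congr (_%:E).
    rewrite /f min_l// -ler_pdivrMr// div1r; apply/ltW.
    by apply: lt_le_trans (truncnS_gt _) _; rewrite ler_nat.
  rewrite indicE memNset//; apply: nearW => n; congr (_%:E).
  have gx : g x = 0.
    by apply/eqP; rewrite eq_le g0 andbT leNgt; apply/negP => /(gW x).2.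
  by rewrite /f gx mulr0 min_r.
have mW := open_measurable_borelRd oW.
have dom (m : {finite_measure set (borelRd R d) -> \bar R}) : m (~` K) = 0%E ->
    (Rintegral m setT (f n))%:E @[n --> \oo] --> m W.
  move=> Km.
  have intf n := continuous_integrable_borelRd cK Km (cf n).
  have [|||||_ _] := @dominated_convergence _ (borelRd R d) R m setT measurableT
    (fun n x => (f n x)%:E) (fun x => (\1_W x)%:E) (cst 1%:E).
  - move=> n; exact: measurable_int (intf n).
  - by apply/measurable_EFinP; exact: measurable_indic.
  - by apply/aeW => x _; exact: flim.
  - apply: measurable_bounded_integrable => //.
      by rewrite ltey_eq fin_num_measure.
    by exists 1; split; [exact: num_real|move=> y y1 x _; rewrite /= normr1 ltW].
  - by apply/aeW => x n _ /=; rewrite lee_fin; have /andP[f0 f1] := f01 n x; rewrite ger0_norm.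
  rewrite integral_indic// setIT; apply: cvg_trans; apply: near_eq_cvg.
  apply: nearW => n; rewrite /Rintegral fineK//.
  exact: integrable_fin_num (intf n).
apply: (@cvg_unique _ (@ereal_hausdorff R) _ _ _ _ (dom m1 K1)).
rewrite (_ : (fun n => _) = (fun n => (Rintegral m2 setT (f n))%:E)); first exact: dom.
apply/funext => n; congr (_%:E); apply: m12 => // x Sx.
have nWx : ~ W x by move=> Wx; have : (W `&` S) x by []; rewrite WS.
have gx : g x = 0.
  by apply/eqP; rewrite eq_le g0 andbT leNgt; apply/negP => /(gW x).2.
by rewrite /f gx mulr0 min_r.
Qed.

Lemma measure_eq_off (B : set (borelRd R d)) : closed S -> measurable B ->
  B `<=` ~` S -> m1 B = m2 B.
Proof.
move=> cS mB BS.
have oS : open (~` S) by exact: closed_openC.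
have mS := open_measurable_borelRd oS.
have -> : B = B `&` ~` S by apply/esym/setIidPl.
apply: (@measure_unique _ R (borelRd R d) (@open V) (fun=> setT) erefl _ _ _
  (mrestr m1 mS) (mrestr m2 mS) _ _ B mB).
- exact: openI.
- by move=> _; exact: openT.
- by rewrite bigcup_const//; exists 0%N.
- move=> A oA; apply: measure_open; first exact: openI.
  by rewrite -setIA setICl setI0.
- by move=> _; rewrite /mrestr ltey_eq fin_num_measure//; exact: measurableI.
Qed.

End MeasureUniqueness.

(** * From moments of linear forms to all continuous functions *)

Section DiscreteFunctional.
Context {R : realType} {d k : nat}.
Local Notation C := R[i].
Local Notation V := 'rV[R]_d.
Variables (K : set V) (E : (V -> C) -> C) (P : 'I_k -> V) (c : 'I_k -> C).
Hypotheses (cK : compact K) (bE : bounded_functional K E).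
Hypothesis moments : forall eta (p : {poly C}),
  E (fun x => p.[(linear_form eta x)%:C%C]) = \sum_i c i * p.[(linear_form eta (P i))%:C%C].

Let L (F : V -> C) := E F + (-1) * \sum_i c i * F (P i).

(** The points [P i] are not known to lie in [K], and the bound for [L] must see them too. *)
Let K' := K `|` range P.

Let cK' : compact K'.
Proof. by apply: compactU => //; apply: finite_compact; exact: finite_image. Qed.

Let bL : bounded_functional K' L.
Proof.
split=> [a F G cF cG|].
  rewrite /L bE.1// mulrDr mulrCA -addrACA; congr (_ + _); rewrite -mulrDr; congr (_ * _).
  rewrite mulr_sumr -big_split/=; apply: eq_bigr => i _.
  by rewrite mulrDr mulrCA.
have [M M0 EM] := bE.2; exists (M + \sum_i cn (c i)).
  by rewrite addr_ge0// sumr_ge0// => i _; exact: cn_ge0.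
move=> F B cF B0 FB; apply: le_trans (cnD _ _) _; rewrite mulrDl; apply: lerD.
  by apply: EM => // x Kx; apply: FB; left.
rewrite mulN1r cnN mulr_suml; elim/big_ind2: _ => [|z r z' r' h h'|i _].
- by rewrite cn0.
- exact: le_trans (cnD _ _) (lerD h h').
- by rewrite cnM ler_wpM2l ?cn_ge0// FB//; right; exists i.
Qed.

Let L_approx (A : set (V -> R)) (f : V -> R) : continuous f ->
  (forall a, A a -> continuous a) -> (forall c, A (fun=> c)) ->
  (forall a b, A a -> A b -> A (fun x => a x + b x)) ->
  (forall a b, A a -> A b -> A (fun x => a x * b x)) ->
  (forall x y, (forall a, A a -> a x = a y) -> f x = f y) ->
  (forall a, A a -> L (fun x => (a x)%:C%C) = 0) -> L (fun x => (f x)%:C%C) = 0.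
Proof.
move=> cf cA A1 AD AM sep LA; apply: (bfun_eq0 bL); first exact: ccont_real.
move=> e e0.
have [a Aa fa] :=
  stone_weierstrass cK' cA A1 AD AM cf (fun x y _ _ => sep x y) e0.
exists (fun x => (a x)%:C%C).
  by split; [exact/ccont_real/cA|exact: LA].
by move=> x Kx; rewrite -rmorphB cn_real ltW// fa.
Qed.

(** The moments concern one linear form at a time, and a product of polynomials in two different
    forms is not of that kind. A product of exponentials of linear forms is again one, and each
    exponential is a uniform limit on [K'] of polynomials in its own form. *)
Let L_exp eta : L (fun x => (expR (linear_form eta x))%:C%C) = 0.
Proof.
apply: (L_approx (A := [set a | exists p : {poly R}, a = fun x => p.[linear_form eta x]])).
- move=> x; apply: (@cvg_comp _ _ _ _ (@expR R)); last exact: continuous_expR.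
  exact: linear_form_continuous.
- move=> _ [p ->] x; apply: (@cvg_comp _ _ _ _ (horner p)); last exact: continuous_horner.
  exact: linear_form_continuous.
- by move=> a; exists a%:P; apply/funext => x; rewrite hornerC.
- by move=> _ _ [p ->] [q ->]; exists (p + q); apply/funext => x; rewrite hornerD.
- by move=> _ _ [p ->] [q ->]; exists (p * q); apply/funext => x; rewrite hornerM.
- move=> x y xy; have := xy (fun x => 'X.[linear_form eta x]) (ex_intro _ 'X erefl).
  by rewrite !hornerX => ->.
move=> _ [p ->]; rewrite /L.
have pE x : (p.[linear_form eta x])%:C%C =
    (map_poly (real_complex R) p).[(linear_form eta x)%:C%C] by rewrite horner_map.
under eq_fun do rewrite pE.
rewrite moments; under [X in _ + _ * X]eq_bigr do rewrite pE.
by rewrite mulN1r subrr.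
Qed.

Lemma discrete_functional (f : V -> R) : continuous f ->
  E (fun x => (f x)%:C%C) = \sum_i c i * (f (P i))%:C%C.
Proof.
move=> cf; suff : L (fun x => (f x)%:C%C) = 0.
  by rewrite /L mulN1r => /eqP; rewrite subr_eq0 => /eqP.
pose ex (s : seq (R * V)) x := \sum_(z <- s) z.1 * expR (linear_form z.2 x).
have cexp eta : continuous (fun x : V => expR (linear_form eta x)).
  move=> x; apply: (@cvg_comp _ _ _ _ (@expR R)); last exact: continuous_expR.
  exact: linear_form_continuous.
apply: (L_approx (A := [set a | exists s, a = ex s])) => //.
- move=> _ [s ->]; apply: (@continuous_linear_comb R V _ s (fun z : R * V => z.1)
    (fun z x => expR (linear_form z.2 x))) => z; exact: cexp.
- move=> a; exists [:: (a, 0)]; apply/funext => x; rewrite /ex big_seq1 /=.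
  rewrite (_ : linear_form 0 x = 0) ?expR0 ?mulr1//.
  by rewrite /linear_form big1// => j _; rewrite mxE mul0r.
- by move=> _ _ [s ->] [t ->]; exists (s ++ t); apply/funext => x; rewrite /ex big_cat.
- move=> _ _ [s ->] [t ->].
  exists [seq (z.1 * w.1, z.2 + w.2) | z <- s, w <- t]; apply/funext => x.
  rewrite /ex big_allpairs_dep big_distrlr /=; apply: eq_bigr => z _; apply: eq_bigr => w _.
  rewrite -[w.2 in RHS]scale1r linear_formDZ mul1r expRD.
  by rewrite mulrACA.
- move=> x y xy; congr f; apply/rowP => j.
  have := xy _ (ex_intro _ [:: (1, delta_mx 0 j)] erefl).
  rewrite /ex !big_seq1 /= !mul1r => /expR_inj.
  by rewrite !(linear_formC (delta_mx _ _)) !linear_form_delta.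
move=> _ [s ->].
have -> : (fun x => (ex s x)%:C%C) =
    (fun x => \sum_(z <- s) (z.1)%:C%C * (expR (linear_form z.2 x))%:C%C).
  by apply/funext => x; rewrite rmorph_sum; apply: eq_bigr => z _; rewrite rmorphM.
rewrite (bfun_sum bL) => [|z]; last by apply: ccont_real; exact: cexp.
by rewrite big1// => z _; rewrite L_exp mulr0.
Qed.

End DiscreteFunctional.

Theorem theorem5p6 (R : realType) (n : nat) (hn : (1 <= n)%N)
  (mu : cmeasure R n.*2.+1) (hmu : cm_compactly_supported mu)
  (I : Type) (f : I -> cpoly R n.*2.+1) (hf : harmonic_spanning f)
  (m : nat) (hrank : infmx_rank_eq (Hmx mu f) m) :
  exists s : seq (Rd R n.*2.+1),
    (size s <= m)%N /\ csupport mu `<=` [set x | x \in s].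
Proof.
have [_ [K [cK muK]]] := hmu.
have bE := cintegral_bounded_functional cK muK.
have d1 : (1 < n.*2.+1)%N by rewrite ltnS double_gt0.
have [k [P [c [km moments]]]] :=
  discrete_moments cK bE (isotropic_plane bE hf hrank cK d1).
have disc := discrete_functional cK bE moments.
exists [seq P i | i <- enum 'I_k]; split; first by rewrite size_map size_enum_ord.
pose S : set 'rV[R]_(n.*2.+1) := range P.
have cS : closed S.
  apply: compact_closed; first exact: norm_hausdorff.
  by apply: finite_compact; exact: finite_image.
(* A real test function separates the real and imaginary parts of [disc]. The four components may
   each charge the complement of [S]; only the two differences vanish there. *)
have eqS (g : 'rV[R]_(n.*2.+1) -> R) : continuous g -> (forall x, S x -> g x = 0) ->
    Rintegral (cm_rp mu) setT g = Rintegral (cm_rn mu) setT g /\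
    Rintegral (cm_ip mu) setT g = Rintegral (cm_in mu) setT g.
  move=> cg g0; have := disc g cg.
  rewrite big1 => [|i _]; last by rewrite g0 ?mulr0//; exists i.
  rewrite /cintegral /cint_pos /=.
  rewrite !Rintegral_cst// !mul0r => /eqP; rewrite eq_complex /=.
  rewrite !mul0r !mul1r !subr0 !addr0 !add0r => /andP[].
  by rewrite !subr_eq0 => /eqP -> /eqP ->.
have [k1 k2 k3 k4] := muK.
move=> x sx /=; apply: contrapT => /negP xs.
have [||B [mB BS /negP[]]] := sx (~` S).
- exact: closed_openC.
- by move=> [i _ Pi]; move/negP: xs; apply; rewrite -Pi map_f ?mem_enum.
rewrite /cmval eq_complex /=.
rewrite (measure_eq_off cK k1 k2 (fun g cg g0 => (eqS g cg g0).1) cS mB BS).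
rewrite (measure_eq_off cK k3 k4 (fun g cg g0 => (eqS g cg g0).2) cS mB BS).
by rewrite !subrr !eqxx.
Qed.
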